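(* Let $G$ be a (simple) planar graph with maximum degree $\Delta(G)\ge 17$, and let the palette be $\mathcal{K}=\{1,\dots,\Delta(G)+1\}$. Let $M\subseteq E(G)$ be a matching whose edges are assigned arbitrary colours from $\mathcal{K}$. Then this precolouring can be extended to a proper edge-colouring of all of $G$ using only colours from $\mathcal{K}$.
   Context: A proper edge-colouring assigns colours to edges so that any two edges sharing an end-vertex receive distinct colours. Extending a precolouring means producing a proper edge-colouring of all of $G$ agreeing with the given colours on the precoloured edges. *)

(* Defs.v *)
From mathcomp Require Import all_boot all_order all_algebra.
From mathcomp Require Import all_classical all_reals all_analysis.
Import Order.TTheory GRing.Theory Num.Theory.
Import numFieldNormedType.Exports.

Set Implicit Arguments.
Unset Strict Implicit.
Unset Printing Implicit Defensive.

Section SimpleGraphs.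

(* A finite simple graph on T is a symmetric irreflexive relation e;
   an edge is the two-element set of its end-vertices. *)
Variables (T : finType) (e : rel T).

Definition simple_graph : Prop := symmetric e /\ irreflexive e.

Definition edge_set : {set {set T}} :=
  [set f : {set T} | [exists x, exists y, e x y && (f == [set x; y]%SET)]]%SET.

Definition degree (x : T) : nat := #|[pred y | e x y]|.

Definition max_degree : nat := \max_(x : T) degree x.

(* finset.trivIset: distinct members are disjoint. *)
Definition matching (M : {set {set T}}) : Prop :=
  (M \subset edge_set) /\ finset.trivIset M.

Definition palette (k : nat) : pred nat := [pred i | 1 <= i <= k].

(* Colourings are total functions on {set T}; only their values on the edges
   under consideration matter. *)
Definition colours_from (k : nat) (F : {set {set T}}) (c : {set T} -> nat) :
    Prop :=
  forall f, f \in F -> c f \in palette k.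

Definition proper_edge_colouring (c : {set T} -> nat) : Prop :=
  forall f g, f \in edge_set -> g \in edge_set -> f != g ->
    ~~ [disjoint f & g] -> c f != c g.

End SimpleGraphs.

Section Planarity.

Variables (R : realType) (T : finType) (e : rel T).

Local Open Scope classical_set_scope.
Local Open Scope ring_scope.

(* A drawing in the plane R * R: vertices are distinct points, and every edge
   is a simple arc (a continuous injective image of [0, 1]) joining its
   end-vertices, whose interior contains no vertex and no point of any other
   edge. *)
Definition plane_drawing (pos : T -> R * R) (arc : {set T} -> R -> R * R) :
    Prop :=
  injective pos /\
  forall f, f \in edge_set e ->
    [/\ {within `[0, 1]%classic, continuous (arc f)},
        {in `[0, 1] &, injective (arc f)},
        exists x y, [/\ f = [set x; y]%SET, arc f 0 = pos x
                      & arc f 1 = pos y],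
        forall (t : R) (x : T), t \in `]0, 1[ -> arc f t <> pos x
      & forall g (t s : R), g \in edge_set e -> g != f ->
          t \in `]0, 1[ -> s \in `[0, 1] -> arc f t <> arc g s].

Definition planar : Prop := exists pos arc, plane_drawing pos arc.

End Planarity.
Arguments planar R {T} e.

(* Main.v *)
Require Import Defs.
From mathcomp Require Import all_boot all_order all_algebra.
From mathcomp Require Import all_classical all_reals all_analysis.
From mathcomp Require Import zify lra.

Set Implicit Arguments.
Unset Strict Implicit.
Unset Printing Implicit Defensive.

Import Order.TTheory GRing.Theory Num.Theory.
Import numFieldNormedType.Exports.

(** Let [H] be the set of edges outside [M], give every edge of [H] the list of
    colours not used by [M] at its ends, and list-colour [H] by induction on its
    size.  Write [d] for the degree in [H], [d+] for [d] plus the number of edges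
    of [M] at the vertex, and [k] for the maximum degree.  If [H] is not
    colourable but all its proper subsets are, then [d+ u + d+ v >= k + 3] for
    every edge [uv] of [H], and every nonempty set of vertices with [d = 2] is
    smaller than its neighbourhood: otherwise the edges at some of these vertices
    form an even cycle, which can be coloured last from lists of size 2.  Hence
    the vertices with [d = 2] are fewer than those with [d+ = k].  Together with
    the bounds [3n] and [2n] on the numbers of edges of planar and of bipartite
    planar graphs, applied to [H] and to its edges at the vertices with
    [3 <= d <= i] for [i = 3, 4, 5], a weighted count of degrees gives a
    contradiction; [k = 17] is exactly where the weights balance.

    The two edge bounds do not need the Jordan curve theorem.  By compactness
    the disjoint thirds of the arcs of a drawing are at positive distance, so
    rounding to a fine square grid exhibits the graph as a minor of the grid.  In
    the grid, every edge set that is even at all vertices is the coboundary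
    modulo 2 of a function on the cells.  This duality survives deletions and
    contractions, and comparing the ranks over the field [bool] of the
    vertex-edge and face-edge incidence matrices yields Euler's inequality. *)

(** * Grid duality modulo 2 *)

Section GridDuality.

Local Open Scope ring_scope.

Definition nbrs (q : nat * nat) : seq (nat * nat) :=
  [:: (q.1.+1, q.2); (q.1, q.2.+1)]
  ++ (if q.1 is i.+1 then [:: (i, q.2)] else [::])
  ++ (if q.2 is j.+1 then [:: (q.1, j)] else [::]).

Definition adj : rel (nat * nat) := [rel q q' | q' \in nbrs q].

Definition left_cell (q q' : nat * nat) : nat * nat :=
  if q'.1 == q.1.+1 then (q.1.+1, q.2.+1)
  else if q.1 == q'.1.+1 then q
  else if q'.2 == q.2.+1 then (q.1, q.2.+1) else (q.1.+1, q.2).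

Definition cob (phi : nat * nat -> bool) (q q' : nat * nat) : bool :=
  phi (left_cell q q') + phi (left_cell q' q).

Lemma addrr_bool (x : bool) : x + x = 0.
Proof. by case: x. Qed.

Lemma adjP q q' :
  reflect [\/ q' = (q.1.+1, q.2), q' = (q.1, q.2.+1),
              q = (q'.1.+1, q'.2) | q = (q'.1, q'.2.+1)] (adj q q').
Proof.
case: q q' => i j [i' j'] /=; rewrite /adj /nbrs /=.
apply: (iffP idP).
  rewrite !inE => /or3P [/eqP ->|/eqP ->|]; [by constructor 1|by constructor 2|].
  case: i j => [|i] [|j] //=; rewrite ?inE.
  - by move/eqP => [-> ->]; constructor 4.
  - by move/eqP => [-> ->]; constructor 3.
  - by case/orP => /eqP [-> ->]; [constructor 3|constructor 4].
case=> [[-> ->]|[-> ->]|[-> ->]|[-> ->]]; rewrite ?inE ?eqxx ?orbT //=.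
by case: i' => [|i'] /=; rewrite ?inE ?eqxx ?orbT.
Qed.

Lemma adj_sym : symmetric adj.
Proof.
move=> q q'; apply/adjP/adjP; case=> ->;
  try (by constructor 3; case: q q' => ? ? []);
  try (by constructor 4; case: q q' => ? ? []);
  try (by constructor 1); by constructor 2.
Qed.

Lemma uniq_nbrs q : uniq (nbrs q).
Proof.
case: q => [[|i] [|j]] //=; rewrite ?inE ?xpair_eqE ?andbT; lia.
Qed.

Lemma cob_sym phi q q' : cob phi q q' = cob phi q' q.
Proof. by rewrite /cob addrC. Qed.

Lemma cob_even phi q :
  (0 < q.1)%N -> (0 < q.2)%N -> \sum_(q' <- nbrs q) cob phi q q' = 0.
Proof.
case: q => [[|i] [|j]] // _ _.
rewrite /nbrs /= !big_cons big_nil /cob /left_cell /=.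
rewrite !eqxx.
repeat (rewrite (_ : (i == i.+2) = false); last by lia).
repeat (rewrite (_ : (i.+1 == i.+2) = false); last by lia).
repeat (rewrite (_ : (i.+2 == i.+1) = false); last by lia).
repeat (rewrite (_ : (i.+1 == i.+3) = false); last by lia).
repeat (rewrite (_ : (j.+1 == j.+3) = false); last by lia).
repeat (rewrite (_ : (j == j.+2) = false); last by lia).
do 4 case: (phi _) => //.
Qed.

(* The potential [phi] counts, modulo 2, the crossings of [W] with the ray
   going down from a cell; evenness of [W] makes it consistent on the vertical
   edges too. *)
Lemma even_chain_cob (W : nat * nat -> nat * nat -> bool) :
    (forall q q', W q q' = W q' q) ->
    (forall q, \sum_(q' <- nbrs q) W q q' = 0) ->
  exists phi, forall q q', adj q q' -> W q q' = cob phi q q'.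
Proof.
move=> Wsym Weven.
pose phi (q : nat * nat) :=
  if q.1 is i.+1 then \sum_(j < q.2) W (i, nat_of_ord j) (i.+1, nat_of_ord j)
  else 0 : bool.
have horiz i j : W (i, j) (i.+1, j) = cob phi (i, j) (i.+1, j).
  rewrite /cob /left_cell /= !eqxx.
  rewrite (_ : (i == i.+2) = false); last by lia.
  by rewrite /phi /= big_ord_recr /= addrAC addrr_bool add0r.
have vert i j : W (i, j) (i, j.+1) = cob phi (i, j) (i, j.+1).
  rewrite /cob /left_cell /=.
  rewrite (_ : (i == i.+1) = false); last by lia.
  rewrite (_ : (j == j.+2) = false) ?eqxx; last by lia.
  elim: j => [|j IHj].
    have := Weven (i, 0%N); rewrite /nbrs /phi /= !big_cons.
    case: i => [|i] /=; rewrite ?big_cons ?big_nil ?big_ord1 ?addr0 /=.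
      by move: (W _ _) (W _ _) => [] [].
    rewrite (Wsym (i.+1, 0%N) (i, 0%N)).
    by move: (W _ _) (W _ _) (W _ _) => [] [] [].
  have := Weven (i, j.+1); rewrite /nbrs /phi /= !big_cons.
  move: IHj; rewrite /phi /= [in X in _ -> _ -> X]big_ord_recr /=.
  case: i => [|i] /=; rewrite ?big_cons ?big_nil ?addr0 /=.
    rewrite (Wsym (0%N, j.+1) (0%N, j)) => ->.
    by move: (W _ _) (W _ _) (bigop _ _ _) => [] [] [].
  rewrite (Wsym (i.+1, j.+1) (i.+1, j)) => ->.
  rewrite [in X in _ -> X]big_ord_recr /= (Wsym (i.+1, j.+1) (i, j.+1)).
  move: (W (i.+1, j.+1) _) (W (i.+1, j.+1) _) (W (i, j.+1) _).
  by move: (bigop _ _ _) (bigop _ _ _) => [] [] [] [] [].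
exists phi => q q' /adjP [] E.
- by rewrite E; case: q {E}.
- by rewrite E; case: q {E}.
- by rewrite E Wsym cob_sym; case: q' {E}.
- by rewrite E Wsym cob_sym; case: q' {E}.
Qed.

Fixpoint chain (q : nat * nat) (p : seq (nat * nat)) (u v : nat * nat) : bool :=
  if p is q' :: p' then
    ((u == q) && (v == q') : bool) + ((u == q') && (v == q) : bool)
      + chain q' p' u v
  else 0.

Lemma chain_sym q p u v : chain q p u v = chain q p v u.
Proof.
elim: p q => //= q' p IHp q; rewrite IHp; congr (_ + _).
by rewrite addrC andbC [X in _ + X]andbC.
Qed.

Lemma chain_cat q p1 p2 u v :
  chain q (p1 ++ p2) u v = chain q p1 u v + chain (last q p1) p2 u v.
Proof.
elim: p1 q => [|q' p IHp] q /=; first by rewrite add0r.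
by rewrite IHp addrA.
Qed.

Lemma chain_mem q p u v : chain q p u v -> (u \in q :: p) && (v \in q :: p).
Proof.
elim: p q => //= q' p IHp q.
rewrite !inE; case E: (chain _ _ _ _).
  by move: (IHp _ E); rewrite !inE => /andP [-> ->]; rewrite !orbT.
by do !case: eqP => ? //=; rewrite ?orbT.
Qed.

Lemma sum_pred1_uniq (s : seq (nat * nat)) x :
  uniq s -> \sum_(y <- s) (y == x : bool) = (x \in s).
Proof.
elim: s => [|y s IHs] /=; first by rewrite big_nil.
case/andP=> ys us; rewrite big_cons IHs // inE (eq_sym y).
case: eqP => [->|]; last by rewrite add0r.
by rewrite (negbTE ys) addr0.
Qed.

Lemma chain_boundary q p u : path adj q p ->
  \sum_(v <- nbrs u) chain q p u v = (u == q : bool) + (u == last q p : bool).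
Proof.
elim: p q => [|q' p IHp] q /=.
  by rewrite big1 // addrr_bool.
case/andP=> qq' /IHp {}IHp.
rewrite !big_split /= IHp.
have step x y : adj x y ->
    \sum_(v <- nbrs u) ((u == x) && (v == y) : bool) = (u == x).
  move=> xy; case: eqP => [->|_] /=; last by rewrite big1.
  rewrite sum_pred1_uniq ?uniq_nbrs //; exact: xy.
rewrite !step // 1?adj_sym //.
by move: (u == q) (u == q') (u == last _ _) => [] [] [].
Qed.

Lemma sum_sym_diag (s : seq (nat * nat)) (D : nat * nat -> nat * nat -> bool) :
    (forall q q', D q q' = D q' q) -> (forall q, D q q = 0) ->
  \sum_(q <- s) \sum_(q' <- s) D q q' = 0.
Proof.
move=> Dsym D0; elim: s => [|x s IHs]; first by rewrite big_nil.
rewrite big_cons big_cons D0 add0r.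
under [X in _ + X]eq_bigr do rewrite big_cons Dsym.
by rewrite big_split /= IHs addr0 addrr_bool.
Qed.

End GridDuality.

(** * Euler's inequality for minors of the grid *)

Section GridMinor.

Local Open Scope ring_scope.

Variables (T : finType) (m : nat) (s t : 'I_m -> T).
Variables (B : T -> seq (nat * nat)) (c : T -> nat * nat).
Variables (a b : 'I_m -> nat * nat) (p1 p2 : 'I_m -> seq (nat * nat)).
Hypothesis B_uniq : forall x, uniq (B x).
Hypothesis B_disj : forall x y q, q \in B x -> q \in B y -> x = y.
Hypothesis B_pos : forall x q, q \in B x -> (0 < q.1)%N && (0 < q.2)%N.
Hypothesis path1 : forall i, path adj (c (s i)) (p1 i).
Hypothesis last1 : forall i, last (c (s i)) (p1 i) = a i.
Hypothesis mem1 : forall i, {subset c (s i) :: p1 i <= B (s i)}.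
Hypothesis adj_ab : forall i, adj (a i) (b i).
Hypothesis path2 : forall i, path adj (b i) (p2 i).
Hypothesis last2 : forall i, last (b i) (p2 i) = c (t i).
Hypothesis mem2 : forall i, {subset b i :: p2 i <= B (t i)}.
Hypothesis st_neq : forall i, s i != t i.
Hypothesis simple_st : forall i j,
  (s i == s j) && (t i == t j) || (s i == t j) && (t i == s j) -> i = j.

Let lift i := chain (c (s i)) (p1 i ++ b i :: p2 i).

Let mem_a i : a i \in B (s i).
Proof. by apply: mem1; rewrite -last1 mem_last. Qed.

Let mem_b i : b i \in B (t i).
Proof. by apply: mem2; rewrite mem_head. Qed.

Let liftE i u v : lift i u v = chain (c (s i)) (p1 i) u v
   + (chain (a i) [:: b i] u v + chain (b i) (p2 i) u v).
Proof. by rewrite /lift chain_cat last1 /= addr0. Qed.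

Let inside u v := [exists x, (u \in B x) && (v \in B x)].

Let chain_inside x q p u v :
  {subset q :: p <= B x} -> ~~ inside u v -> chain q p u v = 0.
Proof.
move=> sub /existsPn /(_ x) nuv; apply/negbTE/negP => /chain_mem /andP [qu qv].
by rewrite !sub in nuv.
Qed.

Let lift_outside i u v : ~~ inside u v -> lift i u v = chain (a i) [:: b i] u v.
Proof.
move=> nuv; rewrite liftE (chain_inside (@mem1 i) nuv).
by rewrite (chain_inside (@mem2 i) nuv) add0r addr0.
Qed.

Let outside_ab i : ~~ inside (a i) (b i).
Proof.
apply/existsPn => x; apply/negP => /andP [ax bx].
by have := st_neq i; rewrite (B_disj (mem_a i) ax) (B_disj (mem_b i) bx) eqxx.
Qed.

Let step_ab i j : chain (a j) [:: b j] (a i) (b i) = (i == j).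
Proof.
rewrite /= addr0.
case: (eqVneq i j) => [->|ij].
  rewrite !eqxx /=; case: (eqVneq (a j) (b j)) => [E|_] //=.
  have := st_neq j; rewrite (@B_disj (s j) (t j) (a j)) ?eqxx //.
  by rewrite E.
apply/negbTE/negP => H.
case/negP: ij; apply/eqP/simple_st.
move: H; case: andP => [[/eqP ai /eqP bi] _|_] /=.
  rewrite (@B_disj (s i) (s j) (a i)) ?mem_a ?ai ?mem_a //.
  by rewrite (@B_disj (t i) (t j) (b i)) ?mem_b ?bi ?mem_b ?eqxx.
rewrite add0r => /andP [/eqP ai /eqP bi].
rewrite (@B_disj (s i) (t j) (a i)) ?mem_a ?ai ?mem_b //.
by rewrite (@B_disj (t i) (s j) (b i)) ?mem_b ?bi ?mem_a ?eqxx ?orbT.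
Qed.

Let lift_ab i j : lift j (a i) (b i) = (i == j).
Proof. by rewrite lift_outside ?outside_ab // step_ab. Qed.

Let kept u v := [exists i, chain (a i) [:: b i] u v].

(* [kept] edges model the edges of the minor, [inside] edges are contracted and
   all others are deleted; deleting an edge merges the two cells beside it. *)
Definition admissible (phi : nat * nat -> bool) :=
  forall u v, adj u v -> ~~ inside u v -> ~~ kept u v -> cob phi u v = 0.

Let inc i v : bool := (s i == v : bool) + (t i == v : bool).

Lemma admissible_even phi v : admissible phi ->
  \sum_i inc i v * cob phi (a i) (b i) = 0.
Proof.
move=> adm.
pose K i := chain (a i) [:: b i].
pose D q q' := cob phi q q' + \sum_i K i q q' * cob phi (a i) (b i).
have D0 q q' : adj q q' -> ~~ inside q q' -> D q q' = 0.
  move=> qq' nin; case: (boolP (kept q q')) => [|nk]; last first.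
    rewrite /D adm // big1 ?addr0 // => i _.
    by move/existsPn: nk => /(_ i) /negbTE; rewrite /K => ->; rewrite mul0r.
  case/existsP=> j Kj.
  have qE : (q = a j /\ q' = b j) \/ (q = b j /\ q' = a j).
    move: Kj; rewrite /= addr0; case: andP => [[/eqP -> /eqP ->]|_]; first by left.
    by rewrite add0r => /andP [/eqP -> /eqP ->]; right.
  have -> : D q q' = D (a j) (b j).
    case: qE => [[-> ->]|[-> ->]] //; rewrite /D cob_sym; congr (_ + _).
    by apply: eq_bigr => i _; rewrite /K chain_sym.
  rewrite /D (bigD1 j) //= /K step_ab eqxx mul1r big1 ?addr0 ?addrr_bool // => i ij.
  by rewrite step_ab eq_sym (negbTE ij) mul0r.
have Dsym q q' : D q q' = D q' q.
  rewrite /D cob_sym; congr (_ + _).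
  by apply: eq_bigr => i _; rewrite /K chain_sym.
have sumD : \sum_(q <- B v) \sum_(q' <- nbrs q) D q q' = 0.
  pose D' q q' : bool := if adj q q' then D q q' else 0.
  rewrite -[RHS](@sum_sym_diag (B v) D'); first last.
  - move=> q; rewrite /D'; case: adjP => //.
    case: q => i j /= [] []; lia.
  - by move=> q q'; rewrite /D' adj_sym Dsym.
  rewrite big_seq [RHS]big_seq; apply: eq_bigr => q qv.
  transitivity (\sum_(q' <- nbrs q | q' \in B v) D q q').
    rewrite big_seq_cond [RHS]big_seq_cond [LHS](bigID (fun q' => q' \in B v)) /=.
    rewrite [X in _ + X]big1 ?addr0.
      by apply: eq_bigl => q'; rewrite andbT.
    move=> q' /andP [] /andP [qq' _] nq'; apply: D0 => //.
    apply/existsPn => x; apply/negP => /andP [qx q'x].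
    by rewrite (B_disj qv qx) q'x in nq'.
  rewrite /D' -big_mkcond /=.
  rewrite -[LHS]big_filter -[RHS]big_filter; apply: perm_big.
  apply: uniq_perm; rewrite ?filter_uniq ?uniq_nbrs //.
  by move=> q'; rewrite !mem_filter andbC.
have : \sum_(q <- B v) \sum_(q' <- nbrs q) D q q'
      = \sum_(q <- B v) \sum_(q' <- nbrs q) cob phi q q'
        + \sum_i inc i v * cob phi (a i) (b i).
  under eq_bigr do rewrite big_split /=.
  rewrite big_split /=; congr (_ + _).
  under eq_bigr do rewrite exchange_big /=.
  rewrite exchange_big /=; apply: eq_bigr => i _.
  under eq_bigr => q _ do
    rewrite -mulr_suml (@chain_boundary (a i) [:: b i] q) /= ?adj_ab //.
  rewrite -mulr_suml; congr (_ * _).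
  rewrite big_split /= !sum_pred1_uniq // /inc.
  have memE x q : q \in B x -> (q \in B v) = (x == v).
    move=> qx; apply/idP/eqP => [qv|<-] //; exact: B_disj qx qv.
  by rewrite (memE _ _ (mem_a i)) (memE _ _ (mem_b i)).
rewrite sumD big_seq big1 ?add0r // => q /B_pos /andP [? ?].
exact: cob_even.
Qed.

Lemma even_lift (z : 'I_m -> bool) :
    (forall v, \sum_i z i * inc i v = 0) ->
  exists2 phi, admissible phi & forall i, cob phi (a i) (b i) = z i.
Proof.
move=> zeven; pose W q q' := \sum_i z i * lift i q q'.
have [phi phiE] : exists phi, forall q q', adj q q' -> W q q' = cob phi q q'.
  apply: even_chain_cob => [q q'|q].
    by apply: eq_bigr => i _; rewrite /lift chain_sym.
  rewrite exchange_big /=.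
  under eq_bigr => i _.
    rewrite -mulr_sumr chain_boundary; last first.
      rewrite cat_path path1 /= last1 adj_ab; exact: path2.
    rewrite last_cat /= last2.
    rewrite (_ : _ + _ = \sum_v (q == c v : bool) * inc i v); last first.
      rewrite /inc; under [RHS]eq_bigr do rewrite mulrDr.
      rewrite big_split /=; congr (_ + _).
        rewrite (bigD1 (s i)) //= eqxx mulr1 big1 ?addr0 // => x /negbTE.
        by rewrite eq_sym => ->; rewrite mulr0.
      rewrite (bigD1 (t i)) //= eqxx mulr1 big1 ?addr0 // => x /negbTE.
      by rewrite eq_sym => ->; rewrite mulr0.
    rewrite mulr_sumr; under eq_bigr do rewrite mulrCA; over.
  rewrite exchange_big big1 //= => v _.
  by rewrite -mulr_sumr zeven mulr0.
exists phi => [u v uv nin nk|i].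
  rewrite -phiE // /W big1 // => i _.
  rewrite lift_outside //.
  by move/existsPn: nk => /(_ i) /negbTE ->; rewrite mulr0.
rewrite -phiE // /W (bigD1 i) //= lift_ab eqxx mulr1 big1 ?addr0 // => j ji.
by rewrite lift_ab eq_sym (negbTE ji) mulr0.
Qed.

Let cell (d : 'I_m * bool) :=
  if d.2 then left_cell (a d.1) (b d.1) else left_cell (b d.1) (a d.1).

(* A face is a class of cells that no admissible function separates; only the
   cells beside a kept edge matter, so faces are sets of sides of kept edges. *)
Let same_face (d d' : 'I_m * bool) : bool :=
  `[< forall phi, admissible phi -> phi (cell d) = phi (cell d') >].

Let face d : {set 'I_m * bool} := [set d' | same_face d d'].

Let face_eq d d' : (face d == face d') = same_face d' d.
Proof.
apply/eqP/asboolP => [E phi adm|E].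
  have : d \in face d' by rewrite -E inE; apply/asboolP.
  by rewrite inE => /asboolP ->.
apply/finset.setP => d''; rewrite !inE; apply/asboolP/asboolP => H phi adm.
  by rewrite E // H.
by rewrite -E // H.
Qed.

Let borders (S : {set 'I_m * bool}) i : bool :=
  (face (i, true) == S : bool) + (face (i, false) == S : bool).

Let faces := [set S | [exists i, borders S i]].

Let faces_face S : S \in faces -> exists d, S = face d.
Proof.
rewrite inE => /existsP [i]; rewrite /borders.
by do 2 case: eqP => [<-|_]; eauto.
Qed.

Let borders_even S v : S \in faces -> \sum_i inc i v * borders S i = 0.
Proof.
case/faces_face=> d ->.
pose phi q := `[< forall psi, admissible psi -> psi q = psi (cell d) >].
have adm : admissible phi.
  move=> u w uw nin nk; rewrite /cob.
  suff -> : phi (left_cell u w) = phi (left_cell w u) by rewrite addrr_bool.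
  apply/asboolP/asboolP => H psi apsi; have := apsi _ _ uw nin nk; rewrite /cob -(H _ apsi);
    by case: (psi _) (psi _) => [] [].
rewrite -[RHS](admissible_even v adm); apply: eq_bigr => i _; congr (_ * _).
rewrite /borders /cob !face_eq /same_face /phi /cell /=.
by congr (_ + _); apply: asbool_equiv_eq; split => H psi apsi; rewrite H.
Qed.

Variables (W : {set T}) (g : nat).
Hypothesis W_st : forall i, (s i \in W) && (t i \in W).
Hypothesis W_gt0 : (0 < #|W|)%N.
Hypothesis girth : forall F : {set 'I_m}, F != finset.set0 ->
  (forall v, \sum_(i in F) ((s i == v : bool) + (t i == v : bool)) = 0) ->
  (g <= #|F|)%N.

Let A : 'M[bool]_(m, #|W|) := \matrix_(i, k) inc i (enum_val k).
Let C : 'M[bool]_(#|faces|, m) := \matrix_(k, i) borders (enum_val k) i.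

Let rank_A : (\rank A <= #|W|.-1)%N.
Proof.
have AJ : A *m (const_mx 1%R : 'cV_#|W|) = 0.
  apply/matrixP => i k; rewrite !mxE.
  under eq_bigr do rewrite !mxE mulr1.
  rewrite -(@big_enum_val _ _ _ _ (mem W) (fun v => inc i v)) /= /inc big_split /=.
  have one x : x \in W -> \sum_(v in W) (x == v : bool) = true.
    move=> xW; rewrite (bigD1 x) //= eqxx big1 ?addr0 // => y /andP [_ /negbTE].
    by rewrite eq_sym.
  by case/andP: (W_st i) => /one -> /one ->.
have := mulmx0_rank_max AJ.
rewrite (_ : \rank (const_mx 1%R : 'cV[bool]_#|W|) = 1%N); first by lia.
have : (0 < \rank (const_mx 1%R : 'cV[bool]_#|W|))%N.
  rewrite lt0n mxrank_eq0; apply/eqP => /matrixP /(_ (Ordinal W_gt0) ord0).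
  by rewrite !mxE.
have := rank_leq_col (const_mx 1%R : 'cV[bool]_#|W|); lia.
Qed.

Let sum_faces i (u : {set 'I_m * bool} -> bool) :
  \sum_(S in faces) u S * borders S i
    = u (face (i, true)) + u (face (i, false)).
Proof.
transitivity (\sum_S u S * borders S i).
  rewrite [RHS](bigID (fun S => S \in faces)) /= [X in _ = _ + X]big1 ?addr0 //.
  move=> S; rewrite inE => /existsPn /(_ i) /negbTE ->.
  by rewrite mulr0.
rewrite /borders; under eq_bigr do rewrite mulrDr.
rewrite big_split /=; congr (_ + _).
  rewrite (bigD1 (face (i, true))) //= eqxx mulr1 big1 ?addr0 // => S /negbTE.
  by rewrite eq_sym => ->; rewrite mulr0.
rewrite (bigD1 (face (i, false))) //= eqxx mulr1 big1 ?addr0 // => S /negbTE.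
by rewrite eq_sym => ->; rewrite mulr0.
Qed.

Let rank_C : (\rank C <= #|faces|.-1)%N.
Proof.
case: (posnP #|faces|) => [f0|f_gt0].
  by apply: leq_trans (rank_leq_row _) _; rewrite f0.
have JC : (const_mx 1%R : 'rV_#|faces|) *m C = 0.
  apply/matrixP => k i; rewrite !mxE.
  under eq_bigr do rewrite !mxE.
  by rewrite -(@big_enum_val _ _ _ _ (mem faces) (fun S => 1 * borders S i)) /= sum_faces addrr_bool.
have := mulmx0_rank_max JC.
have : (0 < \rank (const_mx 1%R : 'rV[bool]_#|faces|))%N.
  rewrite lt0n mxrank_eq0; apply/eqP => /matrixP /(_ ord0 (Ordinal f_gt0)).
  by rewrite !mxE.
lia.
Qed.

Let kernel_sub : (kermx A <= C)%MS.
Proof.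
apply/rV_subP => z /sub_kermxP zA.
have [|phi adm phiE] := @even_lift (fun i => z ord0 i).
  move=> v; case: (boolP (v \in W)) => [vW|nvW].
    move/matrixP: zA => /(_ ord0 (enum_rank_in vW v)).
    rewrite mxE [RHS]mxE => zA; apply: etrans zA.
    by apply: eq_bigr => i _; rewrite !mxE enum_rankK_in.
  rewrite big1 // => i _; rewrite /inc.
  case/andP: (W_st i) => si ti.
  by do 2 (case: eqP => [E|_]; first by rewrite -E ?si ?ti in nvW); rewrite mulr0.
pose u (S : {set 'I_m * bool}) : bool := [exists d in S, phi (cell d)].
have uE d : u (face d) = phi (cell d).
  apply/existsP/idP => [[d'] /andP []|pd].
    by rewrite inE => /asboolP ->.
  by exists d; rewrite inE pd andbT; apply/asboolP.
suff -> : z = (\row_k u (enum_val k)) *m C by apply: submxMl.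
apply/matrixP => k i; rewrite !mxE !ord1 -phiE.
under eq_bigr do rewrite !mxE.
by rewrite -(@big_enum_val _ _ _ _ (mem faces) (fun S => u S * borders S i)) /= sum_faces !uE.
Qed.

Lemma grid_minor_edge_bound :
  (g * (m + 2) <= 2 * m + g * #|W|)%N || (m < #|W|)%N.
Proof.
have kerC := mxrankS kernel_sub.
rewrite mxrank_ker in kerC.
have count_faces : (g * #|faces| <= 2 * m)%N.
  apply: (@leq_trans (\sum_(S in faces) #|[set i | borders S i]|)%N).
    rewrite mulnC -sum_nat_const; apply: leq_sum => S Sf; apply: girth.
      by move: (Sf); rewrite inE => /existsP [i iS]; apply/set0Pn; exists i; rewrite inE.
    move=> v; rewrite -[RHS](borders_even v Sf) [RHS](bigID (borders S)) /=.
    rewrite [X in _ = _ + X]big1 ?addr0; last by move=> i /negbTE ->; rewrite mulr0.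
    by apply: eq_big => i; rewrite ?inE // => ->; rewrite mulr1.
  under eq_bigr do rewrite -sum1_card.
  under eq_bigr do rewrite big_mkcond /=.
  rewrite exchange_big /=.
  apply: (@leq_trans (\sum_(i < m) 2)%N); last by rewrite sum_nat_const card_ord mulnC.
  apply: leq_sum => i _.
  rewrite -big_mkcondr /= sum1_card.
  apply: (@leq_trans #|[set face (i, true); face (i, false)]%SET|); last by rewrite cards2; case: (_ != _).
  apply/subset_leq_card/fintype.subsetP => S; rewrite !inE => /andP [_].
  by rewrite inE /borders (eq_sym S) (eq_sym S); do 2 case: eqP.
move: rank_A rank_C kerC count_faces.
case: (ltnP m #|W|) => [|mW]; first by rewrite orbT.
move=> rA rC kC cf; rewrite orbF.
have : (m + 2 <= #|faces| + #|W|)%N by lia.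
move/(leq_mul (leqnn g)); lia.
Qed.

End GridMinor.

(** * From plane drawings to minors of the grid *)

Section Topology.

Local Open Scope classical_set_scope.
Local Open Scope ring_scope.

Definition link (S : nat * nat -> Prop) (q q' : nat * nat) : Prop :=
  exists w, [/\ path adj q w, last q w = q' & forall u, u \in q :: w -> S u].

Lemma link_refl (S : nat * nat -> Prop) q : S q -> link S q q.
Proof. by move=> Sq; exists [::]; split=> // u; rewrite inE => /eqP ->. Qed.

Lemma link_adj (S : nat * nat -> Prop) q q' : S q -> S q' -> adj q q' -> link S q q'.
Proof.
move=> Sq Sq' qq'; exists [:: q']; split => //=; first by rewrite qq'.
by move=> u; rewrite !inE => /orP [] /eqP ->.
Qed.

Lemma link_trans (S : nat * nat -> Prop) q1 q2 q3 :
  link S q1 q2 -> link S q2 q3 -> link S q1 q3.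
Proof.
case=> w [pw lw Sw] [w' [pw' lw' Sw']]; exists (w ++ w'); split.
- by rewrite cat_path pw lw.
- by rewrite last_cat lw.
- move=> u; rewrite -cat_cons mem_cat => /orP [/Sw //|uw'].
  by apply: Sw'; rewrite inE uw' orbT.
Qed.

Lemma link_sym (S : nat * nat -> Prop) q q' : link S q q' -> link S q' q.
Proof.
case=> w [pw <- Sw]; exists (rev (belast q w)); split.
- by rewrite rev_path; apply: sub_path pw => u v /=; rewrite adj_sym.
- by case: w {pw Sw} => //= q1 w; rewrite rev_cons last_rcons.
- move=> u uw; apply: Sw; rewrite lastI -mem_rev rev_rcons.
  by [].
Qed.

Lemma link_sub (S S' : nat * nat -> Prop) q q' :
  (forall u, S u -> S' u) -> link S q q' -> link S' q q'.
Proof. by move=> SS' [w [? ? Sw]]; exists w; split => // u /Sw /SS'. Qed.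

Lemma link_horizontal (S : nat * nat -> Prop) i i' j :
  (i <= i'.+1)%N -> (i' <= i.+1)%N -> S (i, j) -> S (i', j) -> link S (i, j) (i', j).
Proof.
move=> ii' i'i Si Si'; have [/eqP <-|[|]] : (i == i') \/ i' = i.+1 \/ i = i'.+1 by lia.
- exact: link_refl.
- by move=> E; apply: link_adj => //; apply/adjP; constructor 1; rewrite E.
- by move=> E; apply: link_adj => //; apply/adjP; constructor 3; rewrite E.
Qed.

Lemma link_vertical (S : nat * nat -> Prop) i j j' :
  (j <= j'.+1)%N -> (j' <= j.+1)%N -> S (i, j) -> S (i, j') -> link S (i, j) (i, j').
Proof.
move=> jj' j'j Sj Sj'; have [/eqP <-|[|]] : (j == j') \/ j' = j.+1 \/ j = j'.+1 by lia.
- exact: link_refl.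
- by move=> E; apply: link_adj => //; apply/adjP; constructor 2; rewrite E.
- by move=> E; apply: link_adj => //; apply/adjP; constructor 4; rewrite E.
Qed.

Variable R : realType.
Implicit Types (c h x y : R) (p : R * R) (gamma : R -> R * R).

Definition grid_round c h p : nat * nat :=
  (Num.truncn ((p.1 + c) / h), Num.truncn ((p.2 + c) / h)).

Definition grid_near c h p (q : nat * nat) : Prop :=
  `|p.1 + c - h * q.1%:R| <= 2 * h /\ `|p.2 + c - h * q.2%:R| <= 2 * h.

Lemma truncn_itvM h x : 0 < h -> h <= x ->
  [/\ h * (Num.truncn (x / h))%:R <= x, x < h * (Num.truncn (x / h))%:R + h
    & (0 < Num.truncn (x / h))%N].
Proof.
move=> h0 hx; have xh : 0 <= x / h by apply: divr_ge0; lra.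
have := truncn_itv xh; rewrite ler_pdivlMr // ltr_pdivrMr // => /andP [lo hi].
split; first by rewrite mulrC.
  by move: hi; rewrite -addn1 natrD mulrDl mul1r mulrC.
by rewrite truncn_gt0 ler_pdivlMr // mul1r.
Qed.

Lemma truncn_dist h x y : 0 < h -> h <= x -> h <= y -> `|x - y| < h ->
  [/\ (Num.truncn (x / h) <= (Num.truncn (y / h)).+1)%N,
      `|x - h * (Num.truncn (x / h))%:R| <= 2 * h
    & `|x - h * (Num.truncn (y / h))%:R| <= 2 * h].
Proof.
move=> h0 hx hy; rewrite ltr_norml => /andP [xy yx].
have [x1 x2 _] := truncn_itvM h0 hx; have [y1 y2 _] := truncn_itvM h0 hy.
split; last 2 first.
- by rewrite ler_norml; apply/andP; split; lra.
- by rewrite ler_norml; apply/andP; split; lra.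
rewrite -ltnS -(ltr_nat R) -(ltr_pM2l h0).
rewrite -addn1 natrD -addn1 natrD mulrDr mulrDr mulr1; lra.
Qed.

Lemma link_round c h p p' : 0 < h ->
    h <= p.1 + c -> h <= p.2 + c -> h <= p'.1 + c -> h <= p'.2 + c ->
    `|p.1 - p'.1| < h -> `|p.2 - p'.2| < h ->
  link (fun q => [/\ (0 < q.1)%N, (0 < q.2)%N & grid_near c h p q])
    (grid_round c h p) (grid_round c h p').
Proof.
move=> h0 p1 p2 p1' p2' d1 d2.
have d1' : `|p.1 + c - (p'.1 + c)| < h by rewrite opprD addrACA subrr addr0.
have d2' : `|p.2 + c - (p'.2 + c)| < h by rewrite opprD addrACA subrr addr0.
have [a1 a2 a3] := truncn_dist h0 p1 p1' d1'.
have [b1 b2 b3] := truncn_dist h0 p2 p2' d2'.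
have [a1' _ _] := truncn_dist h0 p1' p1 (eq_ind _ (fun z => z < h) d1' _ (distrC _ _)).
have [b1' _ _] := truncn_dist h0 p2' p2 (eq_ind _ (fun z => z < h) d2' _ (distrC _ _)).
have [_ _ q1] := truncn_itvM h0 p1; have [_ _ q1'] := truncn_itvM h0 p1'.
have [_ _ q2] := truncn_itvM h0 p2; have [_ _ q2'] := truncn_itvM h0 p2'.
apply: (@link_trans _ _ (Num.truncn ((p'.1 + c) / h), Num.truncn ((p.2 + c) / h))).
  exact: link_horizontal.
exact: link_vertical.
Qed.

Lemma link_arc c h x y gamma : 0 < h -> x <= y ->
    {within `[x, y], continuous gamma} ->
    (forall t, t \in `[x, y] -> h <= (gamma t).1 + c /\ h <= (gamma t).2 + c) ->
  link (fun q => [/\ (0 < q.1)%N, (0 < q.2)%N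
                   & exists2 t, t \in `[x, y] & grid_near c h (gamma t) q])
    (grid_round c h (gamma x)) (grid_round c h (gamma y)).
Proof.
move=> h0 xy /subspace_continuousP gc bnd.
set S := (X in link X).
pose A : set R := `[x, y]%classic.
have Ax : A x by rewrite /A /= in_itv /= lexx.
have Ay : A y by rewrite /A /= in_itv /= lexx andbT.
have loc t : A t -> \forall t' \near t, A t' ->
    link S (grid_round c h (gamma t)) (grid_round c h (gamma t')).
  move=> At; have := gc _ At.
  move=> /cvg_ballP /(_ h h0).
  rewrite near_withinE; apply: filterS => t' H At'.
  have [[b1 b2] [b1' b2']] := (bnd _ At, bnd _ At').
  have [d1 d2] := H At'.
  apply: link_sub (link_round h0 b1 b2 b1' b2' d1 d2) => q [? ? ?].
  by split => //; exists t.
pose B : set R :=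
  [set t | A t /\ link S (grid_round c h (gamma x)) (grid_round c h (gamma t))]%classic.
suff BA : B = A by move: Ay; rewrite -BA => -[].
have Sx : S (grid_round c h (gamma x)).
  have [b1 b2] := bnd _ Ax.
  have [] : link S (grid_round c h (gamma x)) (grid_round c h (gamma x)).
    by have /nbhs_singleton := loc _ Ax; apply.
  by move=> w [_ _]; apply; rewrite mem_head.
apply: (@segment_connected R x y B _ _ _); rewrite -/A.
- by exists x; split => //; exact: link_refl.
- exists (interior [set t | A t -> B t]%classic); first exact: open_interior.
  apply/seteqP; split => [t [At Bt]|t [At /interior_subset]]; last exact.
  split => //; apply: filterS (loc _ At) => t' H At'; split => //.
  exact: link_trans Bt (H At').
- exists (~` interior [set t | A t -> ~ B t])%classic.
    exact/open_closedC/open_interior.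
  apply/seteqP; split => [t [At Bt]|t [At nt]].
    by split => // /interior_subset; apply.
  apply: contrapT => nBt; apply: nt.
  apply: filterS (loc _ At) => t' H At' [_ Bt']; apply: nBt; split => //.
  exact: link_trans Bt' (link_sym (H At')).
Qed.

Lemma compact_separated (K K' : set (R * R)) :
    compact K -> compact K' -> (forall p, K p -> K' p -> False) ->
  exists2 d : R, 0 < d & forall p p', K p -> K' p' -> d <= `|p - p'|.
Proof.
move=> cK cK' disj.
pose F (pp : (R * R) * (R * R)) : R := `|pp.1 - pp.2|.
have Fc : continuous F.
  move=> pp; apply: cvg_norm; apply: cvgB; [exact: cvg_fst|exact: cvg_snd].
have cF : compact (F @` (K `*` K'))%classic.
  apply: continuous_compact; last exact: compact_setX.
  exact: continuous_subspaceT.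
have clF := compact_closed (@Rhausdorff R) cF.
have nF0 : (~` (F @` (K `*` K')))%classic 0.
  case=> -[p p'] [/= Kp Kp'] /eqP; rewrite /F /= normr_eq0 subr_eq0 => /eqP E.
  by apply: (disj p) => //; rewrite E.
have : nbhs 0 (~` (F @` (K `*` K')))%classic.
  exact: (open_nbhs_nbhs (conj (closed_openC clF) nF0)).
move=> /nbhs_ballP [d /= d0 dF]; exists d => // p p' Kp Kp'.
rewrite leNgt; apply/negP => lt; apply: (dF `|p - p'|).
  by rewrite /ball /= sub0r normrN normr_id.
by exists (p, p').
Qed.

Lemma segment_image_compact x y gamma :
  {within `[x, y], continuous gamma} -> compact (gamma @` `[x, y])%classic.
Proof. by move=> gc; apply: continuous_compact => //; exact: segment_compact. Qed.

Lemma compact_coord_bound (K : set (R * R)) : compact K ->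
  exists M : R, forall p, K p -> - M <= p.1 /\ - M <= p.2.
Proof.
move=> /compact_bounded [M [_ KM]]; exists (M + 1) => p Kp.
have : `|p| <= M + 1 by apply: (KM (M + 1)) => //; rewrite ltrDl.
rewrite prod_normE /= ge_max !ler_norml => /andP [] /andP [? _] /andP [? _].
by split.
Qed.

Lemma grid_near_dist c h p p' q : grid_near c h p q -> grid_near c h p' q ->
  `|p - p'| <= 4 * h.
Proof.
case=> a1 a2 [b1 b2]; rewrite prod_normE /= ge_max.
move: a1 a2 b1 b2; rewrite !ler_norml => /andP [? ?] /andP [? ?] /andP [? ?] /andP [? ?].
by apply/andP; split; apply/andP; split; lra.
Qed.

Lemma finite_common_bound (I : finType) (P : I -> R -> Prop) :
    (forall i d d', P i d -> d' <= d -> 0 < d' -> P i d') ->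
    (forall i, exists2 d, 0 < d & P i d) ->
  exists2 d, 0 < d & forall i, P i d.
Proof.
move=> mono ex.
suff [d d0 Pd] : exists2 d, 0 < d & forall i, i \in enum I -> P i d.
  by exists d => // i; apply: Pd; rewrite mem_enum.
elim: (enum I) => [|i s [d d0 IHd]]; first by exists 1.
have [d' d'0 Pd'] := ex i.
exists (Num.min d d'); first by rewrite lt_min d0.
move=> j; rewrite inE => /orP [/eqP ->|js].
  by apply: mono Pd' _ _; rewrite ?ge_min ?lexx ?orbT // lt_min d0.
by apply: mono (IHd j js) _ _; rewrite ?ge_min ?lexx ?orbT // lt_min d0.
Qed.

End Topology.

Section Thirds.

Local Open Scope classical_set_scope.
Local Open Scope ring_scope.

Variables (T : finType) (src dst : {set T} -> T).

Definition third_owner (fk : {set T} * 'I_3) : T :=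
  if fk.2 == 0%N :> nat then src fk.1 else dst fk.1.

Definition thirds_apart (fk gl : {set T} * 'I_3) : bool :=
  if fk.2 == 1%N :> nat then
    if gl.2 == 1%N :> nat then fk.1 != gl.1 else third_owner gl \notin fk.1
  else
    if gl.2 == 1%N :> nat then third_owner fk \notin gl.1
    else third_owner fk != third_owner gl.

Variables (R : realType) (e : rel T) (pos : T -> R * R) (arc : {set T} -> R -> R * R).
Hypothesis drawing : plane_drawing e pos arc.
Hypothesis srcdst : forall f, f \in edge_set e ->
  [/\ f = [set src f; dst f]%SET, arc f 0 = pos (src f) & arc f 1 = pos (dst f)].

Lemma arc_meet f g (t s : R) : f \in edge_set e -> g \in edge_set e ->
    t \in `[0, 1] -> s \in `[0, 1] -> arc f t = arc g s ->
  f = g /\ t = s \/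
  exists2 x : bool * bool, t = x.1%:R /\ s = x.2%:R &
    (if x.1 then dst f else src f) = (if x.2 then dst g else src g).
Proof.
move=> fE gE t01 s01 E.
have [posI draw] := drawing.
have [_ injf _ novf cross_f] := draw f fE.
have [_ _ _ novg cross_g] := draw g gE.
have [fg|fg] := eqVneq f g; first by left; subst g; split => //; exact: injf.
right.
have endp (r : R) : r \in `[0, 1] -> ~ (r \in `]0, 1[) -> exists b : bool, r = b%:R.
  rewrite !in_itv /= => /andP [r0 r1] nr; case: (ltP 0 r) => r0'.
    exists true; apply/eqP; rewrite eq_le r1 /= leNgt; apply/negP => r1'.
    by apply: nr; rewrite r0' r1'.
  by exists false; apply/eqP; rewrite eq_le r0' r0.
have [bt tE] : exists b : bool, t = b%:R.
  by apply: endp => // t01'; apply: (cross_f g t s) => //; rewrite eq_sym.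
have [bs sE] : exists b : bool, s = b%:R.
  by apply: endp => // s01'; apply: (cross_g f s t).
exists (bt, bs) => //=.
have [_ f0 f1] := srcdst fE; have [_ g0 g1] := srcdst gE.
apply: posI.
move: E; rewrite tE sE.
by case: bt bs {tE sE} => [] []; rewrite /= ?f0 ?f1 ?g0 ?g1.
Qed.

Definition third_interval (k : 'I_3) : interval R := `[k%:R / 3, k.+1%:R / 3].

Lemma third_interval_sub k t : t \in third_interval k -> t \in `[0, 1].
Proof.
case: k => [[|[|[|//]]]] /= ?; rewrite /third_interval !in_itv /= => /andP [? ?];
  apply/andP; split; lra.
Qed.

Lemma thirds_disjoint fk gl t s : fk.1 \in edge_set e -> gl.1 \in edge_set e ->
    thirds_apart fk gl -> t \in third_interval fk.2 -> s \in third_interval gl.2 ->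
  arc fk.1 t <> arc gl.1 s.
Proof.
case: fk gl => [f k] [g l] /= fE gE ap tk sl.
move=> /(arc_meet fE gE (third_interval_sub tk) (third_interval_sub sl)).
have [/setP fS _ _] := srcdst fE; have [/setP gS _ _] := srcdst gE.
have memf b : (if b then dst f else src f) \in f.
  by rewrite fS !inE; case: b; rewrite eqxx ?orbT.
have memg b : (if b then dst g else src g) \in g.
  by rewrite gS !inE; case: b; rewrite eqxx ?orbT.
move: ap tk sl; rewrite /thirds_apart /third_owner /=.
case: k => [[|[|[|//]]]] /= ?; case: l => [[|[|[|//]]]] /= ?;
  rewrite /third_interval !in_itv /= => ap /andP [? ?] /andP [? ?];
  case=> [[E1 E2]|[[[] []] /= [E1 E2] E3]];
  try lra;
  try (by move: ap; rewrite E1 ?E3 eqxx);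
  try (by move: ap; rewrite E3 eqxx);
  try (by move: ap; rewrite E1 (memg true));
  try (by move: ap; rewrite E1 (memg false));
  try (by move: ap; rewrite -E1 (memf true));
  try (by move: ap; rewrite -E1 (memf false)).
Qed.

Lemma thirds_regions : exists (c : T -> nat * nat) (u w : {set T} -> nat * nat)
    (N : {set T} * 'I_3 -> nat * nat -> Prop),
  [/\ forall fk q, N fk q -> (0 < q.1)%N && (0 < q.2)%N,
      forall fk gl q, fk.1 \in edge_set e -> gl.1 \in edge_set e ->
        thirds_apart fk gl -> N fk q -> ~ N gl q
    & forall f, f \in edge_set e ->
        [/\ link (N (f, inord 0)) (c (src f)) (u f),
            link (N (f, inord 1)) (u f) (w f)
          & link (N (f, inord 2)) (w f) (c (dst f))]].
Proof.
have [_ draw] := drawing.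
have cont f : f \in edge_set e -> {within `[0, 1], continuous (arc f)}.
  by case/draw.
have contk f k : f \in edge_set e -> {within [set` third_interval k], continuous (arc f)}.
  move=> /cont; apply: continuous_subspaceW => t /=; exact: third_interval_sub.
pose K (fk : {set T} * 'I_3) : set (R * R) := (arc fk.1 @` [set` third_interval fk.2])%classic.
have [d d0 dK] : exists2 d : R, 0 < d & forall i : ({set T} * 'I_3) * ({set T} * 'I_3),
    i.1.1 \in edge_set e -> i.2.1 \in edge_set e -> thirds_apart i.1 i.2 ->
    forall p p', K i.1 p -> K i.2 p' -> d <= `|p - p'|.
  apply: finite_common_bound => [i d d' H dd' _ fE gE ap p p' Kp Kp'|[fk gl] /=].
    exact: le_trans dd' (H fE gE ap _ _ Kp Kp').
  have [[fE [gE ap]]|nh] := pselect ((fk.1 \in edge_set e) /\ (gl.1 \in edge_set e) /\ thirds_apart fk gl); last first.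
    by exists 1 => // fE gE ap; case: nh.
  have [|||d d0 dP] := @compact_separated R (K fk) (K gl).
  - exact: segment_image_compact (contk _ _ fE).
  - exact: segment_image_compact (contk _ _ gE).
  - by move=> p [t tk tp] [s sl sp]; apply: (thirds_disjoint fE gE ap tk sl); rewrite tp sp.
  - by exists d.
have /choice [M MP] : forall f, exists M : R, f \in edge_set e ->
    forall t, t \in `[0, 1] -> - M <= (arc f t).1 /\ - M <= (arc f t).2.
  move=> f; have [fE|] := boolP (f \in edge_set e); last by exists 0.
  have [M MP] := compact_coord_bound (segment_image_compact (cont _ fE)).
  by exists M => _ t t01; apply: MP; exists t.
pose C := 1 + \sum_f `|M f|.
pose h := Num.min 1 (d / 5).
have h0 : 0 < h by rewrite lt_min ltr01 divr_gt0.
have h1 : h <= 1 by rewrite ge_min lexx.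
have hd : 5 * h <= d.
  have : h <= d / 5 by rewrite ge_min lexx orbT.
  lra.
have bnd f : f \in edge_set e -> forall t, t \in `[0, 1] ->
    h <= (arc f t).1 + C /\ h <= (arc f t).2 + C.
  move=> fE t t01; have [? ?] := MP f fE t t01.
  have : `|M f| <= \sum_f `|M f|.
    by rewrite (bigD1 f) //= lerDl sumr_ge0.
  have := ler_norm (M f); rewrite /C; split; lra.
exists (grid_round C h \o pos), (fun f => grid_round C h (arc f (1 / 3))),
  (fun f => grid_round C h (arc f (2 / 3))).
exists (fun fk q => [/\ (0 < q.1)%N, (0 < q.2)%N
  & exists2 t, t \in third_interval fk.2 & grid_near C h (arc fk.1 t) q]).
split.
- by move=> fk q [-> ->].
- move=> fk gl q fE gE ap [_ _ [t tk nt]] [_ _ [s sl ns]].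
  have := grid_near_dist nt ns.
  have := dK (fk, gl) fE gE ap (arc fk.1 t) (arc gl.1 s).
  have Kt : K fk (arc fk.1 t) by exists t.
  have Ks : K gl (arc gl.1 s) by exists s.
  move=> /(_ Kt Ks) /=; lra.
- move=> f fE; have [_ f0 f1] := srcdst fE.
  have piece (k : 'I_3) : link (fun q => [/\ (0 < q.1)%N, (0 < q.2)%N
      & exists2 t, t \in third_interval k & grid_near C h (arc f t) q])
      (grid_round C h (arc f (k%:R / 3))) (grid_round C h (arc f (k.+1%:R / 3))).
    apply: link_arc => //.
    + by rewrite ler_pM2r ?invr_gt0 // ler_nat.
    + exact: contk.
    + by move=> t tk; apply: bnd => //; apply: third_interval_sub tk.
  have := (piece (inord 0), piece (inord 1), piece (inord 2)).
  rewrite !inordK //= mul0r f0 divff ?f1 //.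
  by case=> [[? ?] ?].
Qed.

End Thirds.

Lemma path_first_hit (P : pred (nat * nat)) u w :
    path adj u w -> ~~ P u -> P (last u w) ->
  exists w1 b w2, [/\ w = w1 ++ b :: w2, forall q, q \in u :: w1 -> ~~ P q & P b].
Proof.
elim: w u => [|v w IHw] u /= ; first by move=> _ /negbTE ->.
case/andP=> uv pw nPu Pl; case: (boolP (P v)) => [Pv|nPv].
  by exists [::], v, w; split => // q; rewrite inE => /eqP ->.
have [w1 [b [w2 [-> nP Pb]]]] := IHw v pw nPv Pl.
exists (v :: w1), b, w2; split => // q; rewrite inE => /orP [/eqP -> //|].
exact: nP.
Qed.

Lemma link_path_mem (S : nat * nat -> Prop) u w x :
    path adj u w -> (forall q, q \in u :: w -> S q) -> x \in u :: w ->
  link S u x /\ link S x (last u w).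
Proof.
move=> pw Sw xw; case/splitPl: xw pw Sw => w1 w2 lx.
rewrite cat_path lx => /andP [p1 p2] Sw; split.
  by exists w1; split => // q qw; apply: Sw; rewrite -cat_cons mem_cat qw.
exists w2; split => //; first by rewrite last_cat lx.
move=> q; rewrite inE => /orP [/eqP ->|qw].
  by apply: Sw; rewrite -lx -cat_cons mem_cat mem_last.
by apply: Sw; rewrite -cat_cons mem_cat qw orbT.
Qed.

Lemma planar_grid_minor (R : realType) (T : finType) (e : rel T) :
    irreflexive e -> planar R e ->
  exists (B : T -> seq (nat * nat)) (c : T -> nat * nat),
  [/\ forall x, uniq (B x),
      forall x y q, q \in B x -> q \in B y -> x = y,
      forall x q, q \in B x -> (0 < q.1)%N && (0 < q.2)%N
    & forall f, f \in edge_set e -> exists x y a b,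
        [/\ f = [set x; y]%SET, x != y,
            link (fun q => q \in B x) (c x) a, adj a b
          & link (fun q => q \in B y) b (c y)]].
Proof.
move=> irr_e [pos [arc drawing]].
have [x0 _|T0] := pickP T; last first.
  by exists (fun _ => [::]), (fun _ => (0, 0)%N); split => // f; rewrite !inE =>
    /existsP [x]; have := T0 x.
have [_ draw] := drawing.
have /choice [sd sdP] : forall f, exists xy : T * T, f \in edge_set e ->
    [/\ f = [set xy.1; xy.2]%SET, arc f 0%R = pos xy.1 & arc f 1%R = pos xy.2].
  move=> f; have [fE|] := boolP (f \in edge_set e); last by exists (x0, x0).
  by have [_ _ [x [y [? ? ?]]] _ _] := draw f fE; exists (x, y).
pose src f := (sd f).1; pose dst f := (sd f).2.
have srcdst f : f \in edge_set e ->
    [/\ f = [set src f; dst f]%SET, arc f 0%R = pos (src f) & arc f 1%R = pos (dst f)].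
  exact: sdP.
have [c [u [w [N [Npos Napart Nlink]]]]] := thirds_regions drawing srcdst.
have src_dst f : f \in edge_set e -> src f != dst f.
  move=> fE; have [fS _ _] := srcdst f fE.
  move: fE; rewrite inE => /existsP [x /existsP [y /andP [exy /eqP fxy]]].
  apply/eqP => sdE; move: fS; rewrite sdE finset.setUid => /finset.setP S1.
  have xE : x == dst f by rewrite -finset.in_set1 -S1 fxy !inE eqxx.
  have yE : y == dst f by rewrite -finset.in_set1 -S1 fxy !inE eqxx orbT.
  by rewrite (eqP xE) (eqP yE) irr_e in exy.
have /choice [w3 w3P] : forall f, exists w3 : (seq (nat * nat)) * seq (nat * nat) * seq (nat * nat),
    f \in edge_set e ->
    [/\ [/\ path adj (c (src f)) w3.1.1, last (c (src f)) w3.1.1 = u f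
           & forall q, q \in c (src f) :: w3.1.1 -> N (f, inord 0) q],
        [/\ path adj (u f) w3.1.2, last (u f) w3.1.2 = w f
           & forall q, q \in u f :: w3.1.2 -> N (f, inord 1) q]
      & [/\ path adj (w f) w3.2, last (w f) w3.2 = c (dst f)
           & forall q, q \in w f :: w3.2 -> N (f, inord 2) q]].
  move=> f; have [fE|] := boolP (f \in edge_set e); last by exists ([::], [::], [::]).
  by have [[w0 ?] [w1 ?] [w2 ?]] := Nlink f fE; exists (w0, w1, w2).
pose ends v f := (if src f == v then c (src f) :: (w3 f).1.1 else [::])
  ++ (if dst f == v then w f :: (w3 f).2 else [::]).
pose B0 v := flatten [seq ends v f | f <- enum (mem (edge_set e))].
have B0P v q : reflect (exists2 f, f \in edge_set e &
    (src f = v /\ q \in c (src f) :: (w3 f).1.1) \/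
    (dst f = v /\ q \in w f :: (w3 f).2)) (q \in B0 v).
  apply: (iffP flatten_mapP) => -[f]; rewrite ?mem_enum => fE.
    rewrite /ends mem_cat => H; exists f => //.
    by case/orP: H; case: eqP => // E qf; [left|right].
  move=> H; exists f; rewrite ?mem_enum //.
  rewrite /ends mem_cat; by case: H => -[<- qf]; rewrite eqxx qf ?orbT.
have B0N v q : q \in B0 v -> exists fk : {set T} * 'I_3,
    [/\ fk.1 \in edge_set e, fk.2 != 1%N :> nat, third_owner src dst fk = v & N fk q].
  case/B0P=> f fE; have [[_ _ N0] _ [_ _ N2]] := w3P f fE.
  case=> -[vE qw].
    by exists (f, inord 0); rewrite /third_owner /= !inordK //; split => //; exact: N0.
  by exists (f, inord 2); rewrite /third_owner /= !inordK //; split => //; exact: N2.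
have B0_disj v v' q : q \in B0 v -> q \in B0 v' -> v = v'.
  move=> /B0N [fk [fE k1 <- Nq]] /B0N [gl [gE l1 <- Nq']].
  apply: contrapT => /eqP ap; apply: (Napart fk gl q) => //.
  by rewrite /thirds_apart (negbTE k1) (negbTE l1).
have B0_link v q : q \in B0 v -> link (fun q => q \in B0 v) q (c v).
  case/B0P=> f fE; have [[p0 l0 _] _ [p2 l2 _]] := w3P f fE.
  case=> -[vE qw].
    rewrite -vE; apply: link_sym; apply: (link_path_mem p0 _ qw).1 => x xw.
    by apply/B0P; exists f => //; left.
  rewrite -vE -l2; apply: (link_path_mem p2 _ qw).2 => x xw.
  by apply/B0P; exists f => //; right.
have u_src f : f \in edge_set e -> u f \in B0 (src f).
  move=> fE; have [[_ l0 _] _ _] := w3P f fE.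
  by apply/B0P; exists f => //; left; rewrite -l0 mem_last.
have w_dst f : f \in edge_set e -> w f \in B0 (dst f).
  by move=> fE; apply/B0P; exists f => //; right; rewrite mem_head.
(* The middle third of each arc is added to the blob of its source, up to the
   first point [(hit f).2] of the blob of its target. *)
have /choice [hit hitP] : forall f, exists s : seq (nat * nat) * (nat * nat),
    f \in edge_set e ->
    [/\ path adj (u f) s.1, adj (last (u f) s.1) s.2, s.2 \in B0 (dst f)
      & forall q, q \in u f :: s.1 -> q \notin B0 (dst f) /\ N (f, inord 1) q].
  move=> f; have [fE|] := boolP (f \in edge_set e); last by exists ([::], (0, 0)%N).
  have [_ [p1 l1 N1] _] := w3P f fE.
  have [||w1 [b [w2 [wE nw1 wb]]]] := @path_first_hit (fun q => q \in B0 (dst f)) _ _ p1.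
  - apply/negP => /(B0_disj _ _ _ (u_src f fE)) E.
    by have := src_dst f fE; rewrite E eqxx.
  - by rewrite l1 w_dst.
  exists (w1, b) => _ /=; move: p1; rewrite wE cat_path /= => /and3P [pw1 ab _].
  split => // q qw; split; first exact: nw1.
  by apply: N1; rewrite wE -cat_cons mem_cat qw.
pose pre v f := if src f == v then u f :: (hit f).1 else [::].
pose pres v := flatten [seq pre v f | f <- enum (mem (edge_set e))].
have presP v q : reflect (exists2 f, f \in edge_set e &
    src f = v /\ q \in u f :: (hit f).1) (q \in pres v).
  apply: (iffP flatten_mapP) => -[f]; rewrite ?mem_enum => fE.
    by rewrite /pre => H; exists f => //; move: H; case: eqP.
  by case=> E qf; exists f; rewrite ?mem_enum // /pre E eqxx.
have pres_B0 v v' q : q \in pres v -> q \in B0 v' -> v = v'.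
  case/presP=> f fE [vE qf] qv'.
  have [_ _ _ /(_ q qf) [nq Nq]] := hitP f fE.
  have [gl [gE l1 oE Nq']] := B0N _ _ qv'.
  have [v'f|nv'f] := boolP (v' \in f); last first.
    case: (Napart (f, inord 1) gl q fE gE _ Nq Nq').
    by rewrite /thirds_apart /= inordK //= (negbTE l1) oE.
  have [/finset.setP fS _ _] := srcdst f fE.
  move: v'f; rewrite fS !inE => /orP [/eqP ->|/eqP v'E] //.
  by rewrite v'E (negbTE nq) in qv'.
exists (fun v => undup (B0 v ++ pres v)), c; split.
- by move=> v; exact: undup_uniq.
- move=> x y q; rewrite !mem_undup !mem_cat => /orP [qx|qx] /orP [qy|qy].
  + exact: B0_disj qx qy.
  + by apply/esym; exact: pres_B0 qy qx.
  + exact: pres_B0 qx qy.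
  + case/presP: qx => f fE [<- qf]; case/presP: qy => g gE [<- qg].
    have [_ _ _ /(_ q qf) [_ Nf]] := hitP f fE.
    have [_ _ _ /(_ q qg) [_ Ng]] := hitP g gE.
    have [->//|fg] := eqVneq f g.
    case: (Napart (f, inord 1) (g, inord 1) q fE gE _ Nf Ng).
    by rewrite /thirds_apart /= inordK.
- move=> x q; rewrite mem_undup mem_cat => /orP [/B0N [fk [_ _ _ /Npos]] //|].
  by case/presP => f fE [_ qf]; have [_ _ _ /(_ q qf) [_ /Npos]] := hitP f fE.
- move=> f fE; exists (src f), (dst f), (last (u f) (hit f).1), (hit f).2.
  have [ph ab bd hitN] := hitP f fE.
  have [fS _ _] := srcdst f fE.
  split => //; first exact: src_dst.
    apply: (@link_trans _ _ (u f)).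
      apply: link_sub (link_sym (B0_link _ _ (u_src f fE))) => q qB.
      by rewrite mem_undup mem_cat qB.
    exists (hit f).1; split => // q qh; rewrite mem_undup mem_cat.
    by apply/orP; right; apply/presP; exists f.
  by apply: link_sub (B0_link _ _ bd) => q qB; rewrite mem_undup mem_cat qB.
Qed.

(** * Edge bounds for planar graphs *)

Section EdgeBounds.

Variables (R : realType) (T : finType) (e : rel T).
Hypothesis irr_e : irreflexive e.
Hypothesis planar_e : planar R e.

Lemma edge_setP (f : {set T}) : f \in edge_set e ->
  exists x y, [/\ x != y, e x y & f = [set x; y]%SET].
Proof.
rewrite inE => /existsP [x /existsP [y /andP [exy /eqP ->]]]; exists x, y; split => //.
by apply/eqP => E; rewrite E irr_e in exy.
Qed.

Lemma edge_set_eq (f g : {set T}) x y : f \in edge_set e -> g \in edge_set e ->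
  x != y -> x \in f -> y \in f -> x \in g -> y \in g -> f = g.
Proof.
have two (h : {set T}) : h \in edge_set e -> x != y -> x \in h -> y \in h -> h = [set x; y]%SET.
  move=> /edge_setP [u [v [uv _ ->]]] xy; rewrite !inE.
  case/orP=> /eqP xE; case/orP => /eqP yE; rewrite xE yE ?eqxx // in xy *.
  exact: finset.setUC.
by move=> fE gE xy xf yf xg yg; rewrite (two f) // (two g).
Qed.

Lemma planar_edge_bound (F : {set {set T}}) (W : {set T}) (g : nat) :
    F \subset edge_set e -> (forall f, f \in F -> f \subset W) -> 0 < #|W| ->
    (forall F' : {set {set T}}, F' \subset F -> F' != finset.set0 ->
       (forall v, ~~ odd #|[set f in F' | v \in f]%SET|) -> g <= #|F'|) ->
  (g * (#|F| + 2) <= 2 * #|F| + g * #|W|) || (#|F| < #|W|).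
Proof.
move=> /fintype.subsetP FE FW W0 girth.
have [B [c [B_uniq B_disj B_pos minor]]] := planar_grid_minor irr_e planar_e.
have /choice [D DP] : forall i : 'I_#|F|, exists D : T * T * (nat * nat) * (nat * nat)
      * seq (nat * nat) * seq (nat * nat),
    let: (x, y, a, b, p1, p2) := D in
    [/\ enum_val i = [set x; y]%SET, x != y,
        [/\ path adj (c x) p1, last (c x) p1 = a & {subset c x :: p1 <= B x}],
        adj a b & [/\ path adj b p2, last b p2 = c y & {subset b :: p2 <= B y}]].
  move=> i; have [x [y [a [b [fE xy [p1 P1] ab [p2 P2]]]]]] := minor _ (FE _ (enum_valP i)).
  by exists (x, y, a, b, p1, p2).
pose s i := (D i).1.1.1.1.1; pose t i := (D i).1.1.1.1.2.
have DP' i : [/\ enum_val i = [set s i; t i]%SET, s i != t i,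
    [/\ path adj (c (s i)) (D i).1.2, last (c (s i)) (D i).1.2 = (D i).1.1.1.2
      & {subset c (s i) :: (D i).1.2 <= B (s i)}],
    adj (D i).1.1.1.2 (D i).1.1.2
  & [/\ path adj (D i).1.1.2 (D i).2, last (D i).1.1.2 (D i).2 = c (t i)
      & {subset (D i).1.1.2 :: (D i).2 <= B (t i)}]].
  by rewrite /s /t; have := DP i; case: (D i) => [[[[[x y] a] b] p1] p2].
have incE i v : ((s i == v : bool) + (t i == v : bool))%R = (v \in enum_val i).
  have [-> st _ _ _] := DP' i; rewrite !inE ![v == _]eq_sym.
  by move: st; case: (s i =P v) => [->|_]; case: (t i =P v) => [->|_] //; rewrite eqxx.
apply: (@grid_minor_edge_bound T #|F| s t B c (fun i => (D i).1.1.1.2)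
  (fun i => (D i).1.1.2) (fun i => (D i).1.2) (fun i => (D i).2) B_uniq B_disj B_pos).
- by move=> i; case: (DP' i) => _ _ [].
- by move=> i; case: (DP' i) => _ _ [].
- by move=> i; case: (DP' i) => _ _ [].
- by move=> i; case: (DP' i).
- by move=> i; case: (DP' i) => _ _ _ _ [].
- by move=> i; case: (DP' i) => _ _ _ _ [].
- by move=> i; case: (DP' i) => _ _ _ _ [].
- by move=> i; case: (DP' i).
- move=> i j H; apply: enum_val_inj; have [-> _ _ _ _] := DP' i; have [-> _ _ _ _] := DP' j.
  case/orP: H => /andP [/eqP -> /eqP ->] //; exact: finset.setUC.
- move=> i; have := FW _ (enum_valP i); have [-> _ _ _ _] := DP' i.
  by rewrite finset.subUset !finset.sub1set.
- by [].
- move=> I I0 even_I.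
  rewrite -(card_imset _ (@enum_val_inj _ _)); apply: girth.
  + by apply/fintype.subsetP => f /imsetP [i _ ->]; exact: enum_valP.
  + by rewrite imset_eq0.
  + move=> v.
    rewrite (_ : [set _ in _ | _]%SET = enum_val @: [set i in I | v \in enum_val i]%SET); last first.
      apply/finset.setP => f; rewrite inE; apply/andP/imsetP.
        by case=> /imsetP [i iI ->] vi; exists i => //; rewrite inE iI.
      by case=> i; rewrite inE => /andP [iI vi] ->; split => //; exact: imset_f.
    rewrite card_imset; last exact: enum_val_inj.
    have := even_I v; under eq_bigr do rewrite incE.
    rewrite -[#|[set i in I | _]%SET|]sum1_card; set S := (X in ~~ odd X).
    suff -> : (\sum_(i in I) (v \in enum_val i))%R = odd S by move=> ->.
    rewrite /S (big_morph odd oddD (erefl : odd 0 = false)) [RHS]big_mkcond [LHS]big_mkcond /=.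
    by apply: eq_bigr => i _; rewrite inE; case: (i \in I); case: (v \in _).
Qed.

Lemma even_other_edge (F : {set {set T}}) v f :
    ~~ odd #|[set f in F | v \in f]%SET| -> f \in F -> v \in f ->
  exists2 f', f' \in F & v \in f' /\ f' != f.
Proof.
move=> ev fF vf; rewrite (cardsD1 f) inE fF vf /= negbK in ev.
have /card_gt0P [f'] : 0 < #|[set f in F | v \in f]%SET :\ f| by case: #|_| ev.
by rewrite !inE => /and3P [? ? ?]; exists f'.
Qed.

Lemma planar_edges_lt (F : {set {set T}}) (W : {set T}) :
    F \subset edge_set e -> (forall f, f \in F -> f \subset W) -> 0 < #|W| ->
  #|F| < 3 * #|W|.
Proof.
move=> FE FW W0; suff : (3 * (#|F| + 2) <= 2 * #|F| + 3 * #|W|) || (#|F| < #|W|) by lia.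
apply: planar_edge_bound => // F' F'F /set0Pn [f fF'] even_F'.
have sub h : h \in F' -> h \in edge_set e by move/(fintype.subsetP F'F)/(fintype.subsetP FE).
have [x [y [xy _ fxy]]] := edge_setP (sub f fF').
have xf : x \in f by rewrite fxy !inE eqxx.
have yf : y \in f by rewrite fxy !inE eqxx orbT.
have [f1 f1F [xf1 f1f]] := even_other_edge (even_F' x) fF' xf.
have [f2 f2F [yf2 f2f]] := even_other_edge (even_F' y) fF' yf.
have f12 : f1 != f2.
  apply/eqP => E; case/eqP: f1f; apply: (@edge_set_eq _ _ x y) => //; [exact: sub|exact: sub|].
  by rewrite E.
have us : uniq [:: f; f1; f2] by rewrite /= !inE negb_or ![f == _]eq_sym f1f f2f f12.
rewrite -[3]/(size [:: f; f1; f2]) -(card_uniqP us); apply/subset_leq_card/fintype.subsetP => h.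
by rewrite !inE => /or3P [] /eqP ->.
Qed.

Lemma planar_bipartite_edges_le (F : {set {set T}}) (A W : {set T}) :
    F \subset edge_set e -> (forall f, f \in F -> f \subset W) ->
    (forall f, f \in F -> exists a b, [/\ a \in A, b \notin A & f = [set a; b]%SET]) ->
  #|F| <= 2 * #|W|.
Proof.
move=> FE FW bip; case: (posnP #|W|) => [/eqP|W0].
  rewrite cards_eq0 => /eqP W0; rewrite W0 cards0 muln0 leqn0 cards_eq0; apply/eqP/finset.setP => f.
  rewrite inE; apply/negP => fF; have [a [b [_ _ fab]]] := bip f fF.
  by move/fintype.subsetP/(_ a): (FW f fF); rewrite fab W0 !inE eqxx => /(_ isT).
suff : (4 * (#|F| + 2) <= 2 * #|F| + 4 * #|W|) || (#|F| < #|W|) by lia.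
apply: planar_edge_bound => // F' F'F /set0Pn [f fF'] even_F'.
have bip' h : h \in F' -> exists a b, [/\ a \in A, b \notin A & h = [set a; b]%SET].
  by move/(fintype.subsetP F'F)/bip.
have memA a a' b : a \in A -> a' \in A -> b \notin A -> (a' \in [set a; b]%SET) = (a' == a).
  move=> aA a'A bA; rewrite !inE; case: (eqVneq a' b) => [E|]; last by rewrite orbF.
  by rewrite -E a'A in bA.
have memB a b b' : a \in A -> b \notin A -> b' \notin A -> (b' \in [set a; b]%SET) = (b' == b).
  move=> aA bA b'A; rewrite !inE; case: (eqVneq b' a) => [E|] //.
  by rewrite E aA in b'A.
have [a [b [aA bA fE]]] := bip' f fF'.
have af : a \in f by rewrite fE !inE eqxx.
have bf : b \in f by rewrite fE !inE eqxx orbT.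
have [f1 f1F [af1 f1f]] := even_other_edge (even_F' a) fF' af.
have [f2 f2F [bf2 f2f]] := even_other_edge (even_F' b) fF' bf.
have [a1 [b1 [a1A b1A f1E]]] := bip' f1 f1F.
have [a2 [b2 [a2A b2A f2E]]] := bip' f2 f2F.
have aa1 : a1 = a by move: af1; rewrite f1E memA // => /eqP.
have bb2 : b2 = b by move: bf2; rewrite f2E memB // => /eqP.
subst a1 b2.
have a2a : a2 != a by apply: contra f2f => /eqP E; rewrite f2E fE E.
have b1b : b1 != b by apply: contra f1f => /eqP E; rewrite f1E fE E.
have a2f2 : a2 \in f2 by rewrite f2E !inE eqxx.
have [f3 f3F [a2f3 f3f2]] := even_other_edge (even_F' a2) f2F a2f2.
have f12 : f1 != f2 by apply/eqP => E; move: a2f2; rewrite -E f1E memA // (negbTE a2a).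
have f3f : f3 != f by apply/eqP => E; move: a2f3; rewrite E fE memA // (negbTE a2a).
have f31 : f3 != f1 by apply/eqP => E; move: a2f3; rewrite E f1E memA // (negbTE a2a).
have us : uniq [:: f; f1; f2; f3].
  by rewrite /= !inE !negb_or ![f == _]eq_sym [f1 == f3]eq_sym [f2 == f3]eq_sym f1f f2f f3f f12 f31 f3f2.
rewrite -[4]/(size [:: f; f1; f2; f3]) -(card_uniqP us).
apply/subset_leq_card/fintype.subsetP => h.
by rewrite !inE => /or4P [] /eqP ->.
Qed.

End EdgeBounds.

(** * List colouring *)

Section ListColouring.

Variables (X : finType) (r : rel X).
Hypothesis r_sym : symmetric r.
Implicit Types (L : X -> seq nat) (H C D Y I : {set X}).

Definition list_colourable L H : Prop := exists c : X -> nat,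
  (forall f, f \in H -> c f \in L f) /\
  (forall f g, f \in H -> g \in H -> f != g -> r f g -> c f != c g).

Lemma list_colourable_extend L H C :
    C \subset H -> list_colourable L (H :\: C) ->
    (forall c, list_colourable (fun f => [seq i <- L f |
        ~~ [exists g, [&& g \in H :\: C, r f g & c g == i]]]) C) ->
  list_colourable L H.
Proof.
move=> /fintype.subsetP CH [c [cL cP]] ext.
have [c' [c'L c'P]] := ext c.
have new f g : f \in C -> g \in H :\: C -> r f g -> c' f != c g.
  move=> fC gC rfg; have := c'L f fC; rewrite mem_filter => /andP [/existsPn /(_ g)].
  by rewrite gC rfg /= eq_sym.
exists (fun f => if f \in C then c' f else c f); split => [f fH|f g fH gH fg rfg].
  case: ifP => fC; last by apply: cL; rewrite inE fC.
  by have := c'L f fC; rewrite mem_filter => /andP [].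
case: ifP => fC; case: ifP => gC.
- exact: c'P.
- by apply: new => //; rewrite inE gC.
- by rewrite eq_sym; apply: new => //; rewrite ?inE ?fC // r_sym.
- by apply: cP => //; rewrite inE ?fC ?gC.
Qed.

Lemma size_filter_used (s : seq nat) (c : X -> nat) (G : {set X}) : uniq s ->
  size s <= size [seq i <- s | ~~ [exists g, (g \in G) && (c g == i)]] + #|G|.
Proof.
move=> us; rewrite size_filter -(count_predC (fun i => ~~ [exists g, (g \in G) && (c g == i)]) s).
rewrite leq_add2l -size_filter cardE -(size_map c); apply: uniq_leq_size.
  exact: filter_uniq.
move=> i; rewrite mem_filter /= negbK => /andP [/existsP [g /andP [gG /eqP <-]] _].
by apply: map_f; rewrite mem_enum.
Qed.

Lemma list_colourable_add1 L H f : f \in H -> uniq (L f) ->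
    #|[set g in H :\ f | r f g]%SET| < size (L f) ->
  list_colourable L (H :\ f) -> list_colourable L H.
Proof.
move=> fH uL lt col; apply: (@list_colourable_extend L H [set f]%SET) => //.
  by rewrite finset.sub1set.
move=> c; set L' := fun _ => _.
have : 0 < size (L' f).
  have := size_filter_used c [set g in H :\ f | r f g]%SET uL.
  rewrite (_ : [seq i <- L f | _] = L' f); first by lia.
  by apply: eq_filter => i; congr (~~ _); apply: eq_existsb => g; rewrite !inE -!andbA.
case E : (L' f) => [|i s] // _; exists (fun _ => i); split.
  by move=> g /set1P ->; rewrite E mem_head.
by move=> g h /set1P -> /set1P ->; rewrite eqxx.
Qed.

Variables (s : X -> X) (kappa : pred X) (C0 : {set X}).
Hypothesis s_C0 : forall x, x \in C0 -> s x \in C0.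
Hypothesis s_kappa : forall x, x \in C0 -> kappa (s x) = ~~ kappa x.

Lemma alternating_kernel Y : Y \subset C0 ->
  exists I, [/\ I \subset Y, forall x, x \in I -> s x \notin I
              & forall x, x \in Y -> x \notin I -> s x \in I].
Proof.
have [n] := ubnP #|Y|; elim: n Y => // n IHn Y ltY YC.
have [/exists_inP [y yY syY]|/exists_inPn closed] := boolP [exists y in Y, s y \notin Y].
  pose Y' := [set x in Y :\ y | s x != y]%SET.
  have Y'Y : Y' \subset Y by apply/fintype.subsetP => x; rewrite !inE => /andP [/andP []].
  have [||I [/fintype.subsetP IY' indI domI]] := IHn Y'.
  - rewrite ltnS in ltY; apply: leq_trans ltY; apply: proper_card; apply/properP; split => //.
    by exists y => //; rewrite !inE eqxx.
  - exact: fintype.subset_trans Y'Y YC.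
  exists (y |: I)%SET; split.
  - apply/fintype.subsetP => x; rewrite !inE => /orP [/eqP -> //|/IY'].
    exact: (fintype.subsetP Y'Y).
  - move=> x; rewrite !inE => /orP [/eqP ->|xI].
      rewrite negb_or; apply/andP; split; first by apply: contraNneq syY => ->.
      by apply: contra syY => /IY' /(fintype.subsetP Y'Y).
    by rewrite negb_or indI // andbT; have := IY' _ xI; rewrite !inE => /andP [].
  - move=> x xY; rewrite !inE negb_or => /andP [xy xI].
    by case: (eqVneq (s x) y) => //= sxy; apply: domI => //; rewrite !inE xy xY.
exists [set x in Y | kappa x]%SET; split.
- by apply/fintype.subsetP => x; rewrite inE => /andP [].
- move=> x; rewrite !inE => /andP [xY kx].
  by rewrite s_kappa ?kx ?andbF // (fintype.subsetP YC).
- move=> x xY; rewrite !inE xY /= => nk.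
  rewrite s_kappa ?(fintype.subsetP YC) // nk andbT.
  by have := closed x xY; rewrite negbK.
Qed.

(* Galvin's argument, one colour at a time: a kernel [I] of the vertices that
   admit colour [i] takes it, and every other such vertex loses one colour but
   also its only out-neighbour. *)
Lemma alternating_list_colouring D L : D \subset C0 ->
    (forall x, x \in D -> uniq (L x) /\ 1 + (s x \in D) <= size (L x)) ->
  exists c : X -> nat, forall x, x \in D ->
    c x \in L x /\ (s x \in D -> c x != c (s x)).
Proof.
have [n] := ubnP #|D|; elim: n D L => // n IHn D L ltD DC HL.
have [->|/set0Pn [x0 x0D]] := eqVneq D finset.set0.
  by exists (fun _ => 0) => x; rewrite inE.
have [i iL] : exists i, i \in L x0.
  by have [_] := HL x0 x0D; case: (L x0) => // i l _; exists i; rewrite mem_head.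
pose Y := [set x in D | i \in L x]%SET.
have YD : Y \subset D by apply/fintype.subsetP => x; rewrite inE => /andP [].
have [I [/fintype.subsetP IY indI domI]] := alternating_kernel (fintype.subset_trans YD DC).
have ID x : x \in I -> x \in D by move/IY/(fintype.subsetP YD).
have [x1 x1I] : exists x1, x1 \in I.
  have [x0I|x0I] := boolP (x0 \in I); first by exists x0.
  by exists (s x0); apply: domI => //; rewrite inE x0D.
have [|||c cP] := IHn (D :\: I)%SET (fun x => [seq j <- L x | j != i]).
- rewrite ltnS in ltD; apply: leq_trans ltD; apply: proper_card; apply/properP; split.
    exact: finset.subsetDl.
  by exists x1; rewrite ?ID // inE x1I.
- exact: fintype.subset_trans (finset.subsetDl _ _) DC.
- move=> x; rewrite inE => /andP [xI xD]; have [uL sL] := HL x xD.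
  rewrite filter_uniq //; split => //.
  have sE : size [seq j <- L x | j != i] = size (L x) - (i \in L x).
    have -> : [seq j <- L x | j != i] = rem i (L x) by rewrite rem_filter.
    have [iLx|iLx] := boolP (i \in L x); first by rewrite size_rem // subn1.
    by rewrite rem_id // subn0.
  rewrite sE inE; have [iLx|iLx] := boolP (i \in L x).
    have sxI : s x \in I by apply: domI; rewrite // inE xD.
    by rewrite sxI /= ; move: sL; rewrite (ID _ sxI); lia.
  by move: sL; case: (s x \in D); case: (s x \in I) => /=; lia.
exists (fun x => if x \in I then i else c x) => x xD.
have cD y : y \in D -> y \notin I -> c y \in L y /\ c y != i.
  move=> yD yI; have [] := cP y; first by rewrite inE yI.
  by rewrite mem_filter => /andP [].
case: ifP => xI.
  split; first by have := IY _ xI; rewrite inE => /andP [].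
  by move=> sxD; rewrite (negbTE (indI _ xI)) eq_sym; apply: (cD _ sxD (indI _ xI)).2.
have [cL ci] := cD x xD (negbT xI); split => // sxD.
case: ifP => [//|sxI]; apply: (cP x _).2; rewrite inE ?xI ?sxI //.
Qed.

Lemma list_colourable_add_alternating L H : C0 \subset H ->
    (forall x, x \in H -> uniq (L x)) ->
    (forall x y, x \in C0 -> y \in C0 -> x != y -> r x y -> y = s x \/ x = s y) ->
    (forall x, x \in C0 -> #|[set g in H :\: C0 | r x g]%SET| + 2 <= size (L x)) ->
  list_colourable L (H :\: C0) -> list_colourable L H.
Proof.
move=> CH uL conf szL col; apply: (list_colourable_extend CH col) => c.
set L' := fun _ => _.
have [x xC|c' c'P] := @alternating_list_colouring C0 L' (fintype.subxx _).
  have uLx := uL _ (fintype.subsetP CH _ xC).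
  split; first exact: filter_uniq.
  have := size_filter_used c [set g in H :\: C0 | r x g]%SET uLx.
  have := szL x xC; rewrite s_C0 //.
  rewrite (_ : [seq i <- L x | _] = L' x); last first.
    by apply: eq_filter => i; congr (~~ _); apply: eq_existsb => g; rewrite !inE -!andbA.
  move=> H1 /(leq_trans H1); rewrite addnC leq_add2r.
  by [].
exists c'; split => [x /c'P []//|x y xC yC xy rxy].
case: (conf x y xC yC xy rxy) => ->; first by apply: (c'P x xC).2; exact: s_C0.
by rewrite eq_sym; apply: (c'P y yC).2; exact: s_C0.
Qed.

End ListColouring.

Lemma two_involutions_alternate (X : finType) (al be : X -> X) (C : {set X}) (x0 : X) :
    involutive al -> involutive be ->
    (forall x, x \in C -> (al x \in C) && (al x != x)) ->
    (forall x, x \in C -> (be x \in C) && (be x != x)) -> x0 \in C ->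
  exists (C0 : {set X}) (s : X -> X) (kappa : pred X),
    [/\ x0 \in C0, C0 \subset C, forall x, x \in C0 -> s x \in C0,
        forall x, x \in C0 -> kappa (s x) = ~~ kappa x
      & forall x, x \in C0 -> [/\ al x \in C0, be x \in C0,
          al x = s x \/ x = s (al x) & be x = s x \/ x = s (be x)]].
Proof.
move=> alK beK alC beC x0C.
pose sg x := be (al x).
have sg_inj : injective sg by apply: inj_comp; apply: can_inj.
pose O := [set x | fconnect sg x0 x]%SET.
have iterC n x : x \in C -> iter n sg x \in C.
  by move=> xC; elim: n => //= n IHn; case/andP: (beC _ (proj1 (andP (alC _ IHn)))).
have OC x : x \in O -> x \in C.
  by rewrite inE => /iter_findex <-; exact: iterC.
have al_iter n x : x \in C -> al x != iter n sg x.
  have [k] := ubnP n; elim: k n x => // k IHk [|[|n]] x ltk xC.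
  - by case/andP: (alC x xC).
  - have /andP [axC _] := alC x xC; have /andP [_] := beC _ axC.
    by rewrite eq_sym.
  have sxC : sg x \in C by apply: (iterC 1).
  have : al (sg x) != iter n sg (sg x) by apply: IHk => //; rewrite ltnS in ltk; apply: leq_trans ltk.
  apply: contra => /eqP E; rewrite -iterSr; apply/eqP/sg_inj.
  by rewrite -iterS -E /sg alK beK.
have O_al x : x \in O -> al x \notin O.
  move=> xO; apply/negP => axO; have xC := OC _ xO.
  have : fconnect sg x (al x).
    apply: (@connect_trans _ _ x0); last by rewrite inE in axO.
    by rewrite fconnect_sym //; rewrite inE in xO.
  by move=> /iter_findex E; have := al_iter (findex sg x (al x)) x xC; rewrite E eqxx.
have O_sg x : x \in O -> sg x \in O.
  rewrite !inE => x0x; apply: connect_trans x0x _; exact: fconnect1.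
have O_sgV x : x \in O -> exists2 z, z \in O & x = sg z.
  move=> xO; exists (finv sg x); last by rewrite f_finv.
  rewrite inE; rewrite inE in xO; apply: connect_trans xO _; exact: fconnect_finv.
pose O' := [set al x | x in O]%SET.
have OO' x : x \in O' -> x \notin O by case/imsetP => y yO ->; exact: O_al.
exists (O :|: O')%SET, (fun x => if x \in O then al x else be x), (fun x => x \in O).
have s_O x : x \in O -> al x \in O' by move=> xO; apply: imset_f.
have s_O' x : x \in O' -> be x \in O by case/imsetP => y yO ->; exact: O_sg.
have be_O x : x \in O -> be x \in O'.
  by case/O_sgV => z zO ->; rewrite /sg beK; exact: s_O.
have al_O' x : x \in O' -> al x \in O by case/imsetP => y yO ->; rewrite alK.
have x0O : x0 \in O by rewrite inE connect0.
split.
- by rewrite inE x0O.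
- apply/fintype.subsetP => x; rewrite inE => /orP [/OC //|/imsetP [y /OC yC ->]].
  by case/andP: (alC y yC).
- move=> x; rewrite finset.in_setU => /orP [xO|xO'].
    by rewrite /= xO finset.in_setU s_O ?orbT.
  by rewrite /= (negbTE (OO' _ xO')) finset.in_setU s_O'.
- move=> x; rewrite finset.in_setU => /orP [xO|xO'] /=.
    by rewrite xO (negbTE (O_al _ xO)).
  by rewrite (negbTE (OO' _ xO')) s_O'.
- move=> x; rewrite finset.in_setU => /orP [xO|xO'] /=; rewrite !finset.in_setU.
    rewrite s_O // be_O // xO !orbT; split => //; first by left.
    by right; rewrite (negbTE (OO' _ (be_O _ xO))) beK.
  rewrite al_O' // s_O' //; split => //.
    by right; rewrite alK.
  by left; rewrite (negbTE (OO' _ xO')).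
Qed.

Lemma partner_involution (X : finType) (q : rel X) (C : {set X}) : symmetric q ->
    (forall f, f \in C -> exists g, [/\ g \in C, g != f, q f g
       & forall g', g' \in C -> g' != f -> q f g' -> g' = g]) ->
  exists2 p : X -> X, involutive p & forall f, f \in C ->
    [/\ (p f \in C) && (p f != f), q f (p f)
      & forall g, g \in C -> g != f -> q f g -> g = p f].
Proof.
move=> q_sym uniq_q.
have /choice [p0 p0P] : forall f, exists g, f \in C -> [/\ g \in C, g != f, q f g
       & forall g', g' \in C -> g' != f -> q f g' -> g' = g].
  move=> f; have [fC|] := boolP (f \in C); last by exists f.
  by have [g gP] := uniq_q f fC; exists g.
exists (fun f => if f \in C then p0 f else f) => f; last first.
  by move=> fC; rewrite fC; have [-> -> ? ?] := p0P f fC.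
have [fC|fC] := boolP (f \in C); last by rewrite (negbTE fC).
have [gC gf qfg gU] := p0P f fC; rewrite gC.
have [_ _ _ hU] := p0P _ gC.
symmetry; apply: hU; [exact: fC|by rewrite eq_sym|by rewrite q_sym].
Qed.

Definition meet (T : finType) (f g : {set T}) : bool := ~~ [disjoint f & g].

Lemma meetP (T : finType) (f g : {set T}) :
  reflect (exists2 v, v \in f & v \in g) (meet f g).
Proof.
rewrite /meet -setI_eq0; apply: (iffP (set0Pn _)) => [[v]|[v vf vg]].
  by rewrite finset.in_setI => /andP [? ?]; exists v.
by exists v; rewrite finset.in_setI vf.
Qed.

Lemma meet_sym (T : finType) : symmetric (@meet T).
Proof. by move=> f g; rewrite /meet disjoint_sym. Qed.

Section EvenCycle.

Variable T : finType.
Implicit Types (H F : {set {set T}}) (A S : {set T}) (f g : {set T}) (v : T).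

Definition incident H v : {set {set T}} := [set f in H | v \in f]%SET.

Lemma incident_double_count F S :
  \sum_(v in S) #|incident F v| = \sum_(f in F) #|f :&: S|.
Proof.
under eq_bigr do rewrite -sum1_card big_mkcond /=.
rewrite exchange_big /= [RHS]big_mkcond /=; apply: eq_bigr => f _.
have [fF|fF] := boolP (f \in F); last first.
  by rewrite big1 // => v _; rewrite inE (negbTE fF).
rewrite -big_mkcondr -sum1_card; apply: eq_bigl => v.
by rewrite !inE fF /= andbC.
Qed.

Variables (H : {set {set T}}) (L : {set T} -> seq nat).

Definition nbhd A : {set T} := [set b | [exists a in A, [set a; b]%SET \in H]]%SET.

Lemma nbhd_minimal A : A != finset.set0 -> #|nbhd A| <= #|A| ->
  exists A', [/\ A' \subset A, A' != finset.set0, #|nbhd A'| <= #|A'|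
    & forall a, a \in A' -> A' :\ a != finset.set0 -> #|A' :\ a| < #|nbhd (A' :\ a)|].
Proof.
have [n] := ubnP #|A|; elim: n A => // n IHn A ltA A0 NA.
have [/exists_inP [a aA /andP [Aa0 NAa]]|/exists_inPn none] :=
  boolP [exists a in A, (A :\ a != finset.set0) && (#|nbhd (A :\ a)| <= #|A :\ a|)].
  have [|A' [sA' A'0 NA' minA']] := IHn (A :\ a) _ Aa0 NAa.
    by rewrite (cardsD1 a) aA in ltA.
  by exists A'; split => //; apply: fintype.subset_trans sA' (subsetDl _ _).
exists A; split => // a aA Aa0; have := none a aA.
by rewrite Aa0 /= -ltnNge.
Qed.

Hypothesis H_edge : forall f, f \in H -> #|f| = 2.
Hypothesis uniq_L : forall f, uniq (L f).
Variable A0 : {set T}.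
Hypothesis A0_deg : forall a, a \in A0 -> #|incident H a| = 2.
Hypothesis A0_indep : forall a b, a \in A0 -> [set a; b]%SET \in H -> b \notin A0.

Lemma two_incident_partner F v f : #|incident F v| = 2 -> f \in F -> v \in f ->
  exists g, [/\ g \in F, g != f, v \in g
    & forall g', g' \in F -> g' != f -> v \in g' -> g' = g].
Proof.
move=> two fF vf; move: two; rewrite (cardsD1 f) inE fF vf => /eqP.
rewrite eqSS => /cards1P [g gE].
have : g \in incident F v :\ f by rewrite gE finset.set11.
rewrite !inE => /and3P [gf gF vg]; exists g; split => // g' g'F g'f vg'.
by apply/finset.set1P; rewrite -gE !inE g'f g'F.
Qed.

Section Minimal.

Variable A : {set T}.
Hypothesis A_sub : A \subset A0.

Let C : {set {set T}} := [set f in H | meet f A]%SET.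

Lemma meeting_edgeP f : f \in C -> exists a b,
  [/\ a \in A, b \notin A, b \in nbhd A, [set a; b]%SET \in H & f = [set a; b]%SET].
Proof.
rewrite inE => /andP [fH /meetP [a af aA]].
have : #|f :\ a| == 1 by have := H_edge fH; rewrite (cardsD1 a f) af add1n => -[->].
case/cards1P=> b fb.
have fE : f = [set a; b]%SET by rewrite -fb finset.setD1K.
have abH : [set a; b]%SET \in H by rewrite -fE.
exists a, b; split => //.
  by apply: contra (A0_indep (fintype.subsetP A_sub _ aA) abH); apply: (fintype.subsetP A_sub).
by rewrite inE; apply/exists_inP; exists a.
Qed.

Lemma nbhd_notin b : b \in nbhd A -> b \notin A.
Proof.
rewrite inE => /exists_inP [a aA abH].
by apply: contra (A0_indep (fintype.subsetP A_sub _ aA) abH); apply: (fintype.subsetP A_sub).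
Qed.

Lemma meeting_edge a b : a \in A -> [set a; b]%SET \in H -> [set a; b]%SET \in C.
Proof.
by move=> aA abH; rewrite inE abH; apply/meetP; exists a; rewrite // !inE eqxx.
Qed.

Lemma incident_meeting a : a \in A -> incident C a = incident H a.
Proof.
move=> aA; apply/finset.setP => f; rewrite !inE.
case: (boolP (a \in f)) => af; rewrite ?andbF // !andbT andb_idr // => _.
by apply/meetP; exists a.
Qed.

Lemma nbhd_ge2 a : a \in A -> 2 <= #|nbhd A|.
Proof.
move=> aA; have aA0 := fintype.subsetP A_sub _ aA.
have two : #|incident C a| = 2 by rewrite incident_meeting // A0_deg.
have /card_gt0P [f] : 0 < #|incident C a| by rewrite two.
rewrite inE => /andP [fC af].
have [g [gC gf ag _]] := two_incident_partner two fC af.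
have [a1 [b1 [a1A b1A b1N _ fE]]] := meeting_edgeP fC.
have [a2 [b2 [a2A b2A b2N _ gE]]] := meeting_edgeP gC.
have aE x y : x \in A -> y \notin A -> a \in [set x; y]%SET -> a = x.
  by move=> xA yA; rewrite !inE => /orP [] /eqP // E; rewrite -E aA in yA.
have E1 : a = a1 by apply: (aE _ b1); rewrite // -fE.
have E2 : a = a2 by apply: (aE _ b2); rewrite // -gE.
have b12 : b1 != b2 by apply: contra gf => /eqP E; rewrite gE fE -E1 -E2 E.
rewrite (_ : 2 = #|[set b1; b2]%SET|); last by rewrite cards2 b12.
by apply/subset_leq_card/fintype.subsetP => x; rewrite finset.in_set2 => /orP [] /eqP ->.
Qed.

Hypothesis A_neq0 : A != finset.set0.
Hypothesis nbhd_le : #|nbhd A| <= #|A|.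
Hypothesis A_min : forall a, a \in A -> A :\ a != finset.set0 ->
  #|A :\ a| < #|nbhd (A :\ a)|.

Lemma nbhd_sub a : nbhd (A :\ a) \subset nbhd A.
Proof.
apply/fintype.subsetP => b; rewrite !inE => /exists_inP [a' a'A H'].
by apply/exists_inP; exists a' => //; move: a'A; rewrite inE => /andP [].
Qed.

Lemma A_min' a : a \in A -> #|A| <= #|nbhd (A :\ a)|.
Proof.
move=> aA; have cA : #|A| = #|A :\ a|.+1 by rewrite (cardsD1 a) aA.
rewrite cA; apply: A_min => //; rewrite -card_gt0.
by have := nbhd_ge2 aA; have := nbhd_le; rewrite cA; lia.
Qed.

Lemma meeting_nbhd_ge2 b : b \in nbhd A -> 2 <= #|incident C b|.
Proof.
move=> bN; rewrite leqNgt; apply/negP => lt2.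
move: (bN); rewrite inE => /exists_inP [a aA abH].
have abC := meeting_edge aA abH.
have sub : nbhd (A :\ a) \subset nbhd A :\ b.
  apply/fintype.subsetP => b' b'N; rewrite !finset.in_setD1 (fintype.subsetP (nbhd_sub a)) // andbT.
  apply/eqP => E; move: b'N; rewrite E inE => /exists_inP [a' a'A a'bH].
  move: a'A; rewrite finset.in_setD1 => /andP [a'a a'A].
  have : [set [set a; b]%SET; [set a'; b]%SET]%SET \subset incident C b.
    apply/fintype.subsetP => f; rewrite !finset.inE => /orP [] /eqP ->.
      by move: abC; rewrite !inE eqxx orbT andbT.
    by have := meeting_edge a'A a'bH; rewrite !inE eqxx orbT andbT.
  move/subset_leq_card; rewrite cards2.
  suff -> : [set a; b]%SET != [set a'; b]%SET by move=> H2; have := leq_trans (H2) lt2.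
  apply/eqP => /finset.setP /(_ a'); rewrite !inE eqxx (negbTE a'a) /= => /eqP E'.
  by have := nbhd_notin bN; rewrite -E' a'A.
have := A_min' aA; have := subset_leq_card sub.
by have := cardsD1 b (nbhd A); rewrite bN; lia.
Qed.

(* For a minimal [A] all bounds are tight: every neighbour of [A] has exactly
   two neighbours in [A], so the edges at [A] form even cycles. *)
Lemma meeting_nbhd_eq2 b : b \in nbhd A -> #|incident C b| = 2.
Proof.
move=> bN; have [a aA] := set0Pn _ A_neq0.
have eqN : #|nbhd A| = #|A|.
  by apply/eqP; rewrite eqn_leq nbhd_le (leq_trans (A_min' aA)) // subset_leq_card // nbhd_sub.
have sumC (S : {set T}) : (forall f, f \in C -> #|f :&: S| = 1) ->
    \sum_(v in S) #|incident C v| = #|C|.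
  move=> one; rewrite incident_double_count -sum1_card.
  by apply: eq_bigr => f fC; rewrite one.
have sumA : \sum_(v in A) #|incident C v| = #|C|.
  apply: sumC => f /meeting_edgeP [x [y [xA yA _ _ ->]]].
  rewrite (_ : _ :&: _ = [set x]%SET) ?cards1 //; apply/finset.setP => z; rewrite !inE.
  case: (eqVneq z x) => [->|_] //=; case: (eqVneq z y) => [->|] //=.
  exact: negbTE.
have sumN : \sum_(v in nbhd A) #|incident C v| = #|C|.
  apply: sumC => f /meeting_edgeP [x [y [xA yA yN _ ->]]].
  rewrite (_ : _ :&: _ = [set y]%SET) ?cards1 //; apply/finset.setP => z.
  rewrite finset.in_setI finset.in_set2 finset.in_set1.
  case: (eqVneq z y) => [->|_]; rewrite ?orbT ?yN //= orbF.
  case: (eqVneq z x) => [->|] //=; apply/negP => /nbhd_notin.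
  by rewrite xA.
have C2 : #|C| = #|A| * 2.
  rewrite -sumA -sum_nat_const; apply: eq_bigr => v vA.
  by rewrite incident_meeting // A0_deg // (fintype.subsetP A_sub).
move: sumN; rewrite (bigD1 b) //= C2 -eqN (cardsD1 b (nbhd A)) bN.
have : \sum_(v in nbhd A | v != b) 2 <= \sum_(v in nbhd A | v != b) #|incident C v|.
  by apply: leq_sum => v /andP [vN _]; exact: meeting_nbhd_ge2.
rewrite (_ : \sum_(v in nbhd A | v != b) 2 = #|nbhd A :\ b| * 2); last first.
  by rewrite -sum_nat_const; apply: eq_bigl => v; rewrite finset.in_setD1 andbC.
have := meeting_nbhd_ge2 bN; rewrite /= add1n; lia.
Qed.

End Minimal.

Lemma list_colourable_even_cycle : A0 != finset.set0 -> #|nbhd A0| <= #|A0| ->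
    (forall a b, a \in A0 -> [set a; b]%SET \in H ->
       #|incident H b| <= size (L [set a; b]%SET)) ->
    (forall H', H' \proper H -> list_colourable (@meet T) L H') ->
  list_colourable (@meet T) L H.
Proof.
move=> A00 NA0 szL colH'.
have [A [sA A_0 NA minA]] := nbhd_minimal A00 NA0.
pose C : {set {set T}} := [set f in H | meet f A]%SET.
pose RA f g := [exists a, [&& a \in A, a \in f & a \in g]].
pose RB f g := [exists b, [&& b \notin A, b \in f & b \in g]].
have RA_sym : symmetric RA by move=> f g; apply: eq_existsb => a; rewrite [_ && (_ \in g)]andbC.
have RB_sym : symmetric RB by move=> f g; apply: eq_existsb => a; rewrite [_ && (_ \in g)]andbC.
have degA a : a \in A -> #|incident C a| = 2.
  by move=> aA; rewrite incident_meeting // A0_deg // (fintype.subsetP sA).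
have partA f : f \in C -> exists g, [/\ g \in C, g != f, RA f g
       & forall g', g' \in C -> g' != f -> RA f g' -> g' = g].
  move=> fC; have [a [b [aA bA bN abH fE]]] := meeting_edgeP sA fC.
  have af : a \in f by rewrite fE !inE eqxx.
  have [g [gC gf ag gU]] := two_incident_partner (degA a aA) fC af.
  exists g; split => //; first by apply/existsP; exists a; rewrite aA af.
  move=> g' g'C g'f /existsP [a' /and3P [a'A a'f a'g']]; apply: gU => //.
  suff -> : a = a' by [].
  move: a'f; rewrite fE !inE => /orP [] /eqP // E.
  by rewrite -E a'A in bA.
have partB f : f \in C -> exists g, [/\ g \in C, g != f, RB f g
       & forall g', g' \in C -> g' != f -> RB f g' -> g' = g].
  move=> fC; have [a [b [aA bA bN abH fE]]] := meeting_edgeP sA fC.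
  have bf : b \in f by rewrite fE !inE eqxx orbT.
  have degB := meeting_nbhd_eq2 sA A_0 NA minA bN.
  have [g [gC gf bg gU]] := two_incident_partner degB fC bf.
  exists g; split => //; first by apply/existsP; exists b; rewrite bA bf.
  move=> g' g'C g'f /existsP [b' /and3P [b'A b'f b'g']]; apply: gU => //.
  suff -> : b = b' by [].
  move: b'f; rewrite fE !inE => /orP [] /eqP // E.
  by rewrite E aA in b'A.
have [al alK alP] := partner_involution RA_sym partA.
have [be beK beP] := partner_involution RB_sym partB.
have [f0 f0C] : exists f, f \in C.
  have [a aA] := set0Pn _ A_0.
  have /card_gt0P [f] : 0 < #|incident C a| by rewrite degA.
  by rewrite inE => /andP [fC _]; exists f.
have [||C0 [s [kappa [f0C0 C0C sC0 sk nb]]]] := @two_involutions_alternate _ al be C f0 alK beK _ _ f0C.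
- by move=> f /alP [].
- by move=> f /beP [].
have CH f : f \in C -> f \in H by rewrite inE => /andP [].
have C0H : C0 \subset H by apply/fintype.subsetP => f /(fintype.subsetP C0C)/CH.
apply: (@list_colourable_add_alternating _ (@meet T) (@meet_sym T) s kappa C0) => //.
- move=> f g fC0 gC0 fg /meetP [v vf vg].
  have [fC gC] := (fintype.subsetP C0C _ fC0, fintype.subsetP C0C _ gC0).
  have [_ _ hal hbe] := nb f fC0.
  have [vA|vA] := boolP (v \in A).
    have [_ _ alU] := alP f fC.
    have -> : g = al f.
      by apply: alU => //; [rewrite eq_sym|apply/existsP; exists v; rewrite vA vf].
    exact: hal.
  have [_ _ beU] := beP f fC.
  have -> : g = be f.
    by apply: beU => //; [rewrite eq_sym|apply/existsP; exists v; rewrite vA vf].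
  exact: hbe.
- move=> f fC0; have fC := fintype.subsetP C0C _ fC0.
  have [a [b [aA bA bN abH fE]]] := meeting_edgeP sA fC.
  have [alC0 beC0 _ _] := nb f fC0.
  have bf : b \in f by rewrite fE !inE eqxx orbT.
  have [/andP [beC bef] _ beU] := beP f fC.
  have bbe : b \in be f.
    have [_ /existsP [b' /and3P [b'A b'f b'be]] _] := beP f fC.
    suff -> : b = b' by [].
    move: b'f; rewrite fE !inE => /orP [] /eqP // E.
    by rewrite E aA in b'A.
  rewrite fE; apply: leq_trans (szL a b (fintype.subsetP sA _ aA) abH); rewrite -fE.
  rewrite (_ : 2 = #|[set f; be f]%SET|); last by rewrite cards2 eq_sym bef.
  rewrite -cardsUI [X in _ + X](_ : _ = 0) ?addn0; last first.
    apply/eqP; rewrite cards_eq0; apply/eqP/finset.setP => g.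
    rewrite !finset.inE; apply/negP => /andP [/andP [/andP [gC0 _] _]].
    by case/orP => /eqP E; rewrite E ?fC0 ?beC0 in gC0.
  apply/subset_leq_card/fintype.subsetP => g.
  rewrite finset.in_setU finset.in_set2 => /orP [|/orP [] /eqP ->]; last 2 first.
  + by rewrite inE (CH _ fC) bf.
  + by rewrite inE (CH _ beC) bbe.
  rewrite !finset.inE => /andP [/andP [gC0 gH] /meetP [v vf vg]]; rewrite gH /=.
  move: vf; rewrite fE !inE => /orP [] /eqP E; last by rewrite -E.
  have gC : g \in C.
    by rewrite inE gH; apply/meetP; exists a; rewrite // -E.
  have [_ _ alU] := alP f fC.
  have gal : g = al f.
    apply: alU => //; first by apply: contraNneq gC0 => ->.
    by apply/existsP; exists a; rewrite aA -E vg fE !inE E eqxx.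
  by rewrite gal alC0 in gC0.
- apply: colH'; rewrite finset.properEneq finset.subsetDl andbT; apply/eqP => /finset.setP /(_ f0).
  by rewrite inE f0C0 CH.
Qed.

End EvenCycle.

(** * Discharging *)

Section Discharging.

Variables (R : realType) (T : finType) (e : rel T).
Hypothesis irr_e : irreflexive e.
Hypothesis planar_e : planar R e.
Variables (k : nat) (H : {set {set T}}) (m : T -> nat).
Hypothesis k_ge : 17 <= k.
Hypothesis H_sub : H \subset edge_set e.
Hypothesis m_le1 : forall v, m v <= 1.
Hypothesis deg_le : forall v, #|incident H v| + m v <= k.
Hypothesis heavy : forall a b, [set a; b]%SET \in H ->
  k + 3 <= #|incident H a| + m a + (#|incident H b| + m b).

Local Notation d v := #|incident H v|.

Let W : {set T} := [set v | 0 < d v]%SET.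
Let high (j : nat) : {set T} := [set v | (0 < d v) && (k <= d v + m v + j)]%SET.
Let low (i : nat) : {set T} := [set v | 3 <= d v <= i]%SET.

Lemma incident_edge v : 0 < d v -> exists w, [set v; w]%SET \in H.
Proof.
case/card_gt0P => f; rewrite inE => /andP [fH vf].
have [x [y [_ _ fE]]] := edge_setP irr_e (fintype.subsetP H_sub f fH).
move: vf; rewrite fE !inE => /orP [] /eqP ->; first by exists y; rewrite -fE.
by exists x; rewrite finset.setUC -fE.
Qed.

Lemma edge_incident a b : [set a; b]%SET \in H -> 0 < d b.
Proof.
by move=> abH; apply/card_gt0P; exists [set a; b]%SET; rewrite inE abH !inE eqxx orbT.
Qed.

Lemma degree_neq1 v : d v != 1.
Proof.
apply/eqP => d1; have [|w vwH] := @incident_edge v; first by rewrite d1.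
have := heavy vwH; have := m_le1 v; have := deg_le w; rewrite d1; lia.
Qed.

Lemma low_count i j : i <= 5 -> i + 1 <= j + 3 -> j <= 3 ->
  \sum_(v in low i) d v <= 2 * #|low i| + 2 * #|high j|.
Proof.
move=> i5 ij j3.
pose F : {set {set T}} := [set f in H | meet f (low i)]%SET.
have nb a b : a \in low i -> [set a; b]%SET \in H -> (b \in high j) && (b \notin low i).
  rewrite !inE => /andP [_ ai] abH; rewrite (edge_incident abH) /=.
  have := heavy abH; have := m_le1 a; have := m_le1 b; move: ai k_ge.
  move: (d a) (d b) (m a) (m b) => x y x' y'.
  lia.
have FP f : f \in F -> exists a b, [/\ a \in low i, b \notin low i, b \in high j & f = [set a; b]%SET].
  rewrite inE => /andP [fH /meetP [a af aA]].
  have [x [y [_ _ fE]]] := edge_setP irr_e (fintype.subsetP H_sub f fH).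
  have [b fab] : exists b, f = [set a; b]%SET.
    move: af; rewrite fE !finset.inE => /orP [] /eqP ->; first by exists y.
    by exists x; rewrite finset.setUC.
  rewrite fab in fH; have /andP [? ?] := nb a b aA fH.
  by exists a, b.
have -> : \sum_(v in low i) d v = #|F|.
  transitivity (\sum_(v in low i) #|incident F v|).
    apply: eq_bigr => v vA; congr #|pred_of_set _|; apply/finset.setP => f; rewrite !finset.inE.
    case: (boolP (v \in f)) => vf; rewrite ?andbF // !andbT; apply/esym/andb_idr => _.
    by apply/meetP; exists v.
  rewrite incident_double_count -sum1_card; apply: eq_bigr => f /FP [a [b [aA bA _ ->]]].
  rewrite (_ : _ :&: _ = [set a]%SET) ?cards1 //; apply/finset.setP => z.
  rewrite finset.in_setI finset.in_set2 finset.in_set1.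
  case: (eqVneq z a) => [->|_] //=; case: (eqVneq z b) => [->|] //=.
  exact: negbTE.
apply: (@leq_trans (2 * #|low i :|: high j|)).
  apply: (planar_bipartite_edges_le irr_e planar_e (A := low i)).
  - by apply/fintype.subsetP => f; rewrite inE => /andP [/(fintype.subsetP H_sub)].
  - move=> f /FP [a [b [aA _ bB ->]]]; rewrite finset.subUset !finset.sub1set !finset.in_setU.
    by rewrite aA bB orbT.
  - by move=> f /FP [a [b [? ? _ ?]]]; exists a, b.
by rewrite -mulnDr leq_mul2l /= cardsU leq_subr.
Qed.

Lemma degree2_many : H != finset.set0 -> #|high 0| < #|[set v | d v == 2]%SET|.
Proof.
move=> /set0Pn [f0 f0H].
have edgeH f : f \in H -> exists x y, x != y /\ f = [set x; y]%SET.
  by move/(fintype.subsetP H_sub)/(edge_setP irr_e) => [x [y [? _ ?]]]; exists x, y.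
have W0 : 0 < #|W|.
  have [x [y [_ fE]]] := edgeH _ f0H; apply/card_gt0P; exists y.
  by rewrite inE (@edge_incident x) // -fE.
have total : \sum_v d v < 6 * #|W|.
  have -> : \sum_v d v = 2 * #|H|.
    transitivity (\sum_(v in [set: T]%SET) d v); first by apply: eq_bigl => v; rewrite inE.
    rewrite incident_double_count mulnC -sum_nat_const; apply: eq_bigr => f fH.
    have [x [y [xy ->]]] := edgeH f fH.
    by rewrite finset.setIT cards2 xy.
  suff : #|H| < 3 * #|W| by lia.
  apply: (planar_edges_lt irr_e planar_e) => // f fH; have [x [y [_ fE]]] := edgeH f fH.
  rewrite fE in fH *; rewrite finset.subUset !finset.sub1set !inE (edge_incident fH).
  by rewrite (@edge_incident y) // finset.setUC.
rewrite ltnNge; apply/negP => few2.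
have l3 := @low_count 3 1 isT isT isT.
have l4 := @low_count 4 2 isT isT isT.
have l5 := @low_count 5 3 isT isT isT.
have cardE (S : {set T}) : #|S| = \sum_v (v \in S).
  by rewrite -sum1_card big_mkcond; apply: eq_bigr => v _; case: (v \in S).
have sumE (S : {set T}) : \sum_(v in S) d v = \sum_v (v \in S) * d v.
  by rewrite big_mkcond; apply: eq_bigr => v _; case: (v \in S); rewrite ?mul1n ?mul0n.
move: total few2 l3 l4 l5; rewrite !sumE !cardE.
(* This contradicts [3 total + 12 few2 + 6 l3 + 2 l4 + l5], vertex by vertex. *)
have : \sum_v (18 * (v \in W) + 12 * (v \in high 0) + 12 * (v \in high 1)
     + 4 * (v \in high 2) + 2 * (v \in high 3)
     + 12 * (v \in low 3) + 4 * (v \in low 4) + 2 * (v \in low 5))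
   <= \sum_v (3 * d v + 12 * (v \in [set v | d v == 2]%SET)
     + 6 * ((v \in low 3) * d v) + 2 * ((v \in low 4) * d v) + (v \in low 5) * d v).
  apply: leq_sum => v _; rewrite !inE.
  have := degree_neq1 v; have := m_le1 v; have := deg_le v.
  move: (d v) (m v) => n c nk c1 n1.
  have [|n6] := ltnP n 6.
    have kn j : j <= 3 -> n < 6 -> (k <= n + c + j) = false by lia.
    move=> n6; rewrite !kn //; move: n1 n6; clear nk kn.
    by case: n => [|[|[|[|[|[|n]]]]]].
  have -> : (n == 2) = false by lia.
  have lown i : i <= 5 -> (n <= i) = false by lia.
  rewrite !lown // !andbF !muln0 !addn0 (_ : (0 < n) = true) /=; last by lia.
  by case: (leqP k (n + c + 0)) => ?; case: (leqP k (n + c + 1)) => ?;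
    case: (leqP k (n + c + 2)) => ?; case: (leqP k (n + c + 3)) => ?; lia.
have distr n (F : T -> nat) : \sum_v n * F v = n * \sum_v F v by rewrite big_distrr.
rewrite !(distr, big_split) /=.
lia.
Qed.

End Discharging.

Section Precolouring.

Variables (R : realType) (T : finType) (e : rel T).
Hypothesis simple_e : simple_graph e.
Hypothesis planar_e : planar R e.
Hypothesis large_degree : 17 <= max_degree e.
Variables (M : {set {set T}}) (p : {set T} -> nat).
Hypothesis matching_M : matching e M.

Local Notation k := (max_degree e).

Let L (f : {set T}) : seq nat := [seq i <- iota 1 k.+1 |
  ~~ [exists g, (g \in [set g in M | meet f g]%SET) && (p g == i)]].

Let irr_e : irreflexive e. Proof. by case: simple_e. Qed.

Lemma matching_incident_le1 v : #|incident M v| <= 1.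
Proof.
rewrite leqNgt; apply/negP => /card_gt1P [f [g [+ + fg]]].
rewrite !inE => /andP [fM vf] /andP [gM vg].
have [_ /finset.trivIsetP triv] := matching_M.
by have := triv f g fM gM fg; rewrite disjoint_subset => /fintype.subsetP /(_ v vf); rewrite inE vg.
Qed.

Lemma incident_le_max_degree v : #|incident (edge_set e) v| <= k.
Proof.
apply: (@leq_trans (degree e v)); last by apply: (@leq_bigmax _ (degree e)).
have sub : incident (edge_set e) v \subset [set [set v; y]%SET | y in [pred y | e v y]]%SET.
  apply/fintype.subsetP => f; rewrite inE => /andP [fE vf].
  have [x [y [_ exy fxy]]] := edge_setP irr_e fE.
  move: vf; rewrite fxy !finset.inE => /orP [] /eqP ->; apply/imsetP.
    by exists y.
  by exists x; [rewrite inE; case: simple_e => -> _|exact: finset.setUC].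
by apply: leq_trans (subset_leq_card sub) (leq_imset_card _ _).
Qed.

Lemma incident_matching_le (H : {set {set T}}) v : H \subset edge_set e :\: M ->
  #|incident H v| + #|incident M v| <= k.
Proof.
move=> /fintype.subsetP HE; apply: leq_trans (incident_le_max_degree v).
have [/fintype.subsetP ME _] := matching_M.
rewrite -cardsUI [X in _ + X](_ : _ = 0) ?addn0.
  apply/subset_leq_card/fintype.subsetP => f.
  rewrite finset.in_setU !finset.in_set -andb_orl => /andP [fHM ->]; rewrite andbT.
  have : f \in edge_set e by case/orP: fHM => [/HE|/ME //]; rewrite finset.in_setD => /andP [].
  by rewrite finset.in_set.
apply/eqP; rewrite cards_eq0; apply/eqP/finset.setP => f; rewrite !finset.inE.
by apply/negP => /andP [/andP [/HE + _] /andP [fM _]]; rewrite finset.inE fM.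
Qed.

Lemma meet_incident (F : {set {set T}}) a b g : g \in F -> meet [set a; b]%SET g ->
  g \in incident F a :|: incident F b.
Proof.
move=> gF /meetP [v]; rewrite !finset.inE gF /=.
by case/orP=> /eqP -> ->; rewrite ?orbT.
Qed.

Lemma size_available a b :
  k.+1 <= size (L [set a; b]%SET) + (#|incident M a| + #|incident M b|).
Proof.
have := @size_filter_used _ (iota 1 k.+1) p [set g in M | meet [set a; b]%SET g]%SET (iota_uniq _ _).
rewrite size_iota -/(L _) => /leq_trans; apply; rewrite leq_add2l.
apply: (@leq_trans #|incident M a :|: incident M b|); last by rewrite cardsU leq_subr.
apply/subset_leq_card/fintype.subsetP => g; rewrite inE => /andP [gM ab].
exact: meet_incident.
Qed.

Lemma uncoloured_colourable (H : {set {set T}}) :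
  H \subset edge_set e :\: M -> list_colourable (@meet T) L H.
Proof.
have [n] := ubnP #|H|; elim: n H => // n IHn H ltH HE.
have H_edge : H \subset edge_set e by apply: fintype.subset_trans HE (finset.subsetDl _ _).
have colH' (H' : {set {set T}}) : H' \proper H -> list_colourable (@meet T) L H'.
  move=> H'H; apply: IHn; first exact: leq_trans (proper_card H'H) ltH.
  exact: fintype.subset_trans (proper_sub H'H) HE.
have uniq_L f : uniq (L f) by apply/filter_uniq/iota_uniq.
have [->|H0] := eqVneq H finset.set0.
  by exists (fun _ => 0); split => f; [rewrite inE|move=> g; rewrite inE].
apply: contrapT => nocol.
have deg_le v := incident_matching_le v HE.
have edge_neq a b : [set a; b]%SET \in H -> a != b.
  move=> abH; have [x [y [xy _ E]]] := edge_setP irr_e (fintype.subsetP H_edge _ abH).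
  apply: contra_neq xy => ab; move/finset.setP: E => E.
  have := E x; have := E y; rewrite !finset.inE !eqxx ab !orbb orbT.
  by move=> /eqP -> /eqP ->.
have heavy a b : [set a; b]%SET \in H ->
    k + 3 <= #|incident H a| + #|incident M a| + (#|incident H b| + #|incident M b|).
  move=> abH; rewrite leqNgt; apply/negP => light; apply: nocol.
  apply: (@list_colourable_add1 _ (@meet T) (@meet_sym T) L H [set a; b]%SET) => //.
  - set U := (X in #|pred_of_set X| < _).
    have : #|U| <= #|(incident H a :\ [set a; b]%SET) :|: (incident H b :\ [set a; b]%SET)|.
      apply/subset_leq_card/fintype.subsetP => g; rewrite finset.in_set => /andP [].
      rewrite finset.in_setD1 => /andP [gab gH] /(meet_incident gH).
      by rewrite !finset.in_setU !finset.in_setD1 gab.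
    rewrite cardsU => H1; have H2 := leq_trans H1 (leq_subr _ _).
    have := size_available a b.
    have := cardsD1 [set a; b]%SET (incident H a); have := cardsD1 [set a; b]%SET (incident H b).
    rewrite !finset.inE !eqxx abH orbT /= => E1 E2.
    move: light H2; rewrite E1 E2; clear.
    move: #|U| #|incident H a :\ _| #|incident H b :\ _| (size _) #|incident M a| #|incident M b|.
    lia.
  - apply: colH'; apply/properP; rewrite finset.subD1set; split => //.
    by exists [set a; b]%SET => //; rewrite finset.in_setD1 eqxx.
have many2 := degree2_many irr_e planar_e large_degree H_edge matching_incident_le1 deg_le heavy H0.
apply: nocol.
pose A0 : {set T} := [set v | #|incident H v| == 2]%SET.
have nbhd_high : nbhd H A0 \subset
    [set v | (0 < #|incident H v|) && (k <= #|incident H v| + #|incident M v| + 0)]%SET.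
  apply/fintype.subsetP => b; rewrite !finset.in_set => /exists_inP [a]; rewrite finset.in_set => /eqP a2 abH.
  rewrite (edge_incident abH) /=.
  have := heavy a b abH; have := matching_incident_le1 a; rewrite a2.
  by move: #|incident H b| #|incident M a| #|incident M b| (max_degree e); lia.
apply: (@list_colourable_even_cycle _ H L _ uniq_L A0).
- move=> f /(fintype.subsetP H_edge)/(edge_setP irr_e) [x [y [xy _ ->]]].
  by rewrite cards2 xy.
- by move=> a; rewrite inE => /eqP.
- move=> a b; rewrite !finset.in_set => /eqP a2 abH; have := heavy a b abH.
  have := matching_incident_le1 a; have := matching_incident_le1 b; rewrite a2.
  case: eqP => // ->; move: large_degree.
  by move: #|incident M a| #|incident M b| (max_degree e); lia.
- by rewrite -card_gt0; apply: leq_trans many2.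
- exact: leq_trans (subset_leq_card nbhd_high) (ltnW many2).
- move=> a b _ abH; have := size_available a b; have := deg_le b.
  have := matching_incident_le1 a.
  by move: #|incident H b| #|incident M a| #|incident M b| (size _) (max_degree e); lia.
- exact: colH'.
Qed.

End Precolouring.

Theorem theorem1p9 (R : realType) (T : finType) (e : rel T)
    (simple_e : simple_graph e) (planar_e : planar R e)
    (large_degree : 17 <= max_degree e)
    (M : {set {set T}}) (matching_M : matching e M)
    (p : {set T} -> nat) (p_palette : colours_from (max_degree e).+1 M p) :
  exists c : {set T} -> nat,
    [/\ colours_from (max_degree e).+1 (edge_set e) c,
        proper_edge_colouring e c
      & forall f, f \in M -> c f = p f].
Proof.
have [c [cL cP]] := uncoloured_colourable simple_e planar_e large_degree p matching_M
  (fintype.subxx (edge_set e :\: M)).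
have avail f : f \in edge_set e -> f \notin M ->
    c f \in palette (max_degree e).+1 /\
    forall g, g \in M -> meet f g -> c f != p g.
  move=> fE fM; have := cL f; rewrite inE fE fM => /(_ isT).
  rewrite mem_filter mem_iota => /andP [/existsPn nog cf]; split.
    by rewrite inE; move: cf; rewrite add1n ltnS.
  by move=> g gM fg; have := nog g; rewrite inE gM fg /= eq_sym.
exists (fun f => if f \in M then p f else c f); split => [f fE|f g fE gE fg mfg|f ->//].
  case: ifP => [/p_palette //|/negbT fM]; by case: (avail f fE fM).
case: ifP => fM; case: ifP => gM.
- have [_ /finset.trivIsetP triv] := matching_M.
  by rewrite (triv f g fM gM fg) in mfg.
- by rewrite eq_sym; apply: (avail g gE (negbT gM)).2; rewrite // meet_sym.
- exact: (avail f fE (negbT fM)).2.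
- by apply: cP => //; rewrite finset.in_setD ?fM ?gM ?fE ?gE.
Qed.
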